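(* On compact $4$-dimensional manifolds the number $h^{1,0}_d$ is not an almost complex invariant, nor is it even a complex invariant. That is, there exist a compact manifold $M$ of real dimension $4$, an almost complex structure $J$ on $M$, and two almost Hermitian metrics $g,g'$ on $(M,J)$ such that $h^{1,0}_d(M,J,g)\neq h^{1,0}_d(M,J,g')$; moreover, such an example exists with $J$ integrable.
   Context: An almost complex structure $J$ on $M$ is a $(1,1)$-tensor field with $J^2=-\mathrm{id}$; it is integrable if it is induced by a complex manifold structure. An almost Hermitian metric on $(M,J)$ is a Riemannian metric $g$ for which $J$ is an isometry. $A^{p,q}(M)$ is the space of smooth $(p,q)$-forms, $\Delta_d=dd^*+d^*d$ is the Hodge Laplacian of $g$, and $h^{p,q}_d(M,J,g)=\dim_{\mathbb C}\{\alpha\in A^{p,q}(M):\Delta_d\alpha=0\}$. A quantity attached to $(M,J,g)$ is an almost complex invariant (respectively, complex invariant) if it does not depend on the choice of the almost Hermitian metric $g$ on the almost complex (respectively, complex) manifold $(M,J)$. *)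

(* Defs.v *)
From HB Require Import structures.
From mathcomp Require Import all_boot all_order all_algebra all_fingroup.
From mathcomp Require Import all_classical all_reals all_analysis.
From mathcomp Require Import complex.

Set Implicit Arguments.
Unset Strict Implicit.
Unset Printing Implicit Defensive.

Import Order.TTheory GRing.Theory Num.Theory.
Import numFieldNormedType.Exports.

Local Open Scope classical_set_scope.
Local Open Scope ring_scope.
Local Open Scope complex_scope.

Definition partial (R : realType) (n : nat) (a : 'I_n) (f : 'rV[R]_n -> R) :
    'rV[R]_n -> R :=
  'D_(delta_mx 0 a) f.

(* s ranges over all iterated partial derivatives; U is meant to be open. *)
Definition smooth (R : realType) (n : nat) (U : set 'rV[R]_n)
    (f : 'rV[R]_n -> R) : Prop :=
  forall s : seq 'I_n, let h := foldr (@partial R n) f s in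
    forall y, U y -> {for y, continuous h} /\
                     (forall a, derivable h y (delta_mx 0 a)).

Definition smooth_map (R : realType) (n m : nat) (U : set 'rV[R]_n)
    (f : 'rV[R]_n -> 'rV[R]_m) : Prop :=
  forall c, smooth U (fun y => f y 0 c).

Definition csmooth (R : realType) (n : nat) (U : set 'rV[R]_n)
    (f : 'rV[R]_n -> R[i]) : Prop :=
  smooth U (fun y => complex.Re (f y)) /\ smooth U (fun y => complex.Im (f y)).

Definition cpartial (R : realType) (n : nat) (a : 'I_n)
    (f : 'rV[R]_n -> R[i]) (y : 'rV[R]_n) : R[i] :=
  partial a (fun x => complex.Re (f x)) y +i* partial a (fun x => complex.Im (f x)) y.

(* An atlas with charts in K^n; K is R for real manifolds and R[i] for complex
   ones.  The values of [coord i] off [dom i], and of [param i] off the image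
   of the chart, are irrelevant. *)
Record atlas (K : numFieldType) (n : nat) (M : topologicalType) := Atlas {
  chart_index : Type;
  dom : chart_index -> set M;
  coord : chart_index -> M -> 'rV[K]_n;
  param : chart_index -> 'rV[K]_n -> M;
  dom_open : forall i, open (dom i);
  dom_cover : forall p, exists i, dom i p;
  coord_open : forall i, open (coord i @` dom i);
  coordK : forall i p, dom i p -> param i (coord i p) = p;
  coord_continuous : forall i p, dom i p -> {for p, continuous (coord i)};
  param_continuous : forall i y, (coord i @` dom i) y ->
    {for y, continuous (param i)}
}.

Definition chart_image (K : numFieldType) (n : nat) (M : topologicalType)
    (A : atlas K n M) (i : chart_index A) : set 'rV[K]_n :=
  coord i @` dom i.

(* The two atlases may have different ground fields, in order to compare a
   smooth atlas with a holomorphic one. *)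
Definition overlap (K L : numFieldType) (n m : nat) (M : topologicalType)
    (A : atlas K n M) (B : atlas L m M) (i : chart_index A)
    (j : chart_index B) : set 'rV[K]_n :=
  coord i @` (dom i `&` dom j).

Definition transition (K L : numFieldType) (n m : nat) (M : topologicalType)
    (A : atlas K n M) (B : atlas L m M) (i : chart_index A)
    (j : chart_index B) : 'rV[K]_n -> 'rV[L]_m :=
  coord j \o param i.

Definition smooth_manifold (R : realType) (n : nat) (M : topologicalType)
    (A : atlas R n M) : Prop :=
  [/\ hausdorff_space M, @second_countable M &
    forall i j : chart_index A, smooth_map (overlap i j) (transition i j)].

(* [differentiable] is here over R[i]. *)
Definition holomorphic_atlas (R : realType) (m : nat) (M : topologicalType)
    (B : atlas R[i] m M) : Prop :=
  forall (i j : chart_index B) z, overlap i j z ->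
    differentiable (transition i j) z.

Definition realify (R : realType) (m : nat) (z : 'rV[R[i]]_m) : 'rV[R]_(m + m) :=
  row_mx (\row_c complex.Re (z 0 c)) (\row_c complex.Im (z 0 c)).

Definition complexify (R : realType) (m : nat) (x : 'rV[R]_(m + m)) :
    'rV[R[i]]_m :=
  \row_c (x 0 (lshift m c) +i* x 0 (rshift m c)).

(* The smooth structure underlying B is the one given by A. *)
Definition same_smooth_structure (R : realType) (m : nat) (M : topologicalType)
    (A : atlas R (m + m) M) (B : atlas R[i] m M) : Prop :=
  forall (i : chart_index A) (k : chart_index B),
    smooth_map (overlap i k) (@realify R m \o transition i k) /\
    smooth_map (@complexify R m @^-1` overlap k i)
               (transition k i \o @complexify R m).

(* A tensor field is the family of its components in the charts of the atlas,
   as functions of the coordinates.  Tangent vectors are row vectors; by the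
   convention of ['J], the differential of f at y is v |-> v *m 'J f y, that
   is, ['J f y a b] is the derivative of the b-th component of f along the
   a-th coordinate. *)

(* J maps the tangent vector v at y to v *m J i y. *)
Definition almost_complex (R : realType) (n : nat) (M : topologicalType)
    (A : atlas R n M) (J : chart_index A -> 'rV[R]_n -> 'M[R]_n) : Prop :=
  [/\ forall i a b, smooth (chart_image i) (fun y => J i y a b),
      forall i j y, overlap i j y ->
        J i y *m 'J (transition i j) y =
        'J (transition i j) y *m J j (transition i j y) &
      forall i y, chart_image i y -> J i y *m J i y = - 1%:M].

(* The last clause says that dz o J = 'i dz for every holomorphic coordinate
   z of B: J is multiplication by 'i in the charts of B. *)
Definition integrable_acs (R : realType) (m : nat) (M : topologicalType)
    (A : atlas R (m + m) M)
    (J : chart_index A -> 'rV[R]_(m + m) -> 'M[R]_(m + m)) : Prop :=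
  exists B : atlas R[i] m M,
    [/\ holomorphic_atlas B, same_smooth_structure A B &
      forall (i : chart_index A) (k : chart_index B) y, overlap i k y ->
        forall a c,
          \sum_b (J i y a b)%:C * cpartial b (fun x => transition i k x 0 c) y
          = 'i%C * cpartial a (fun x => transition i k x 0 c) y].

Definition riemannian (R : realType) (n : nat) (M : topologicalType)
    (A : atlas R n M) (g : chart_index A -> 'rV[R]_n -> 'M[R]_n) : Prop :=
  [/\ forall i a b, smooth (chart_image i) (fun y => g i y a b),
      forall i j y, overlap i j y ->
        g i y = 'J (transition i j) y *m g j (transition i j y)
                  *m ('J (transition i j) y)^T,
      forall i y, chart_image i y -> (g i y)^T = g i y &
      forall i y, chart_image i y -> forall v : 'rV[R]_n, v != 0 ->
        0 < (v *m g i y *m v^T) 0 0].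

Definition almost_hermitian (R : realType) (n : nat) (M : topologicalType)
    (A : atlas R n M) (J g : chart_index A -> 'rV[R]_n -> 'M[R]_n) : Prop :=
  riemannian g /\
  forall i y, chart_image i y -> J i y *m g i y *m (J i y)^T = g i y.

(* Components of a complex valued k-form
   w = 1/k! \sum_t w_t dx^(t_1) /\ ... /\ dx^(t_k). *)
Definition local_form (R : realType) (n k : nat) : Type :=
  k.-tuple 'I_n -> 'rV[R]_n -> R[i].

(* The last clause normalizes the irrelevant values off the charts, so that
   equal forms have equal components. *)
Definition is_form (R : realType) (n k : nat) (M : topologicalType)
    (A : atlas R n M) (w : chart_index A -> local_form R n k) : Prop :=
  [/\ forall i t, csmooth (chart_image i) (w i t),
      forall i t y, chart_image i y -> forall s : 'S_k,
        w i [tuple tnth t (s l) | l < k] y = (-1) ^+ s * w i t y,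
      forall i j y, overlap i j y -> forall t,
        w i t y =
        \sum_(s : k.-tuple 'I_n)
          (\prod_(l < k) 'J (transition i j) y (tnth t l) (tnth s l))%:C
          * w j s (transition i j y) &
      forall i t y, ~ chart_image i y -> w i t y = 0].

Definition ext_d (R : realType) (n k : nat) (w : local_form R n k) :
    local_form R n k.+1 :=
  fun t y => \sum_(j < k.+1)
    (-1) ^+ j * cpartial (tnth t j) (w [tuple tnth t (lift j l) | l < k]) y.

(* The Levi-Civita symbol of a sequence of length n. *)
Definition levi_civita (R : realType) (n : nat) (s : seq 'I_n) : R :=
  \det (\matrix_(i < n, j < n) (nth n (map val s) i == j)%:R).

(* The C-linear Hodge star from k-forms to m-forms, where n = k + m, for the
   orientation of the coordinates:
   ( *w)_s = 1/k! sqrt(det g) \sum_(a, b)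
               eps_(a s) g^(a_1 b_1) ... g^(a_k b_k) w_b. *)
Definition hodge_star (R : realType) (n k m : nat) (g : 'rV[R]_n -> 'M[R]_n)
    (w : local_form R n k) : local_form R n m :=
  fun s y => \sum_(a : k.-tuple 'I_n) \sum_(b : k.-tuple 'I_n)
    (k`!%:R^-1 * Num.sqrt (\det (g y)) * levi_civita R (a ++ s)
      * \prod_(l < k) invmx (g y) (tnth a l) (tnth b l))%:C * w b y.

(* On p-forms, p = k + 1, d^* is (-1)^(n (p + 1) + 1) * d *; it does not depend
   on the orientation, which occurs twice. *)
Definition codiff (R : realType) (n k : nat) (g : 'rV[R]_n -> 'M[R]_n)
    (w : local_form R n k.+1) : local_form R n k :=
  fun t y => (-1) ^+ (n * k.+2).+1
    * hodge_star g (ext_d (hodge_star (m := n - k.+1) g w)) t y.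

(* The Hodge Laplacian d d^* + d^* d in positive degree. *)
Definition laplacian (R : realType) (n k : nat) (g : 'rV[R]_n -> 'M[R]_n)
    (w : local_form R n k.+1) : local_form R n k.+1 :=
  fun t y => ext_d (codiff g w) t y + codiff g (ext_d w) t y.

(* A^{1,0}: the 1-forms w with w (J v) = 'i * w v. *)
Definition is_form10 (R : realType) (n : nat) (M : topologicalType)
    (A : atlas R n M) (J : chart_index A -> 'rV[R]_n -> 'M[R]_n)
    (w : chart_index A -> local_form R n 1) : Prop :=
  is_form w /\
  forall i y, chart_image i y -> forall a,
    \sum_b (J i y a b)%:C * w i [tuple b] y = 'i%C * w i [tuple a] y.

Definition harmonic10 (R : realType) (n : nat) (M : topologicalType)
    (A : atlas R n M) (J g : chart_index A -> 'rV[R]_n -> 'M[R]_n) :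
    set (chart_index A -> local_form R n 1) :=
  [set w | is_form10 J w /\
    forall i y, chart_image i y -> forall t, laplacian (g i) (w i) t y = 0].

(* The complex dimension, possibly +oo, of a subspace V of a space of families
   of functions: the largest size of a linearly independent family in V. *)
Definition cdim (R : realType) (I T E : Type) (V : set (I -> T -> E -> R[i])) :
    \bar R :=
  ereal_sup [set m%:R%:E | m in [set m : nat |
    exists b : 'I_m -> I -> T -> E -> R[i],
      (forall l, V (b l)) /\
      forall c : 'I_m -> R[i],
        (forall i t y, \sum_l c l * b l i t y = 0) -> forall l, c l = 0]].

Definition h10 (R : realType) (n : nat) (M : topologicalType)
    (A : atlas R n M) (J g : chart_index A -> 'rV[R]_n -> 'M[R]_n) : \bar R :=
  cdim (harmonic10 J g).

(* Main.v *)
(* M is the torus R^4 / Z^4 = C^2 / Z[i]^2 with its complex structure J; g is the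
   flat metric and g' = phi g for the positive periodic function
   phi = 2 + sin (2 pi x_1).  For g the forms dz_1 and dz_2 are harmonic, so that
   h^{1,0} >= 2.  For g', let w be a harmonic (1,0)-form and h = d^* w.  In
   dimension 4 the operator d^* d on 1-forms is phi^-1 times the flat one, and
   the equation Delta w = 0 reads
     phi d_b h = sum_p (d_p d_p w_b - d_p d_b w_p).
   The divergence of the right hand side vanishes, hence
   sum_b d_b (phi d_b h) = 0 and h is constant by the maximum principle.
   The right hand side then vanishes, that is, Lap w_b = d_b D with D = div w;
   since w has type (1,0), this makes D holomorphic, hence constant; so the w_b
   are harmonic functions, hence constant.
   Finally h = - phi^-2 sum_p d_p (phi w_p) = - phi^-2 (d_1 phi) w_1 is constant
   only if w_1 = 0, whence h^{1,0} <= 1.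
   No integration is needed: the maximum principle replaces Stokes' theorem. *)
Require Import Defs.
From HB Require Import structures.
From mathcomp Require Import all_boot all_order all_algebra all_fingroup.
From mathcomp Require Import all_classical all_reals all_analysis.
From mathcomp Require Import complex ring lra zify generic_quotient.
Set Implicit Arguments.
Unset Strict Implicit.
Unset Printing Implicit Defensive.
Import Order.TTheory GRing.Theory Num.Theory.
Import numFieldNormedType.Exports.
Local Open Scope classical_set_scope.
Local Open Scope ring_scope.

(** The obstacle is to get a Liouville theorem from the bare maximum principle. A maximum only tells
    the first derivatives and the sign of the second ones at that point, so the gradient of h is
    controlled by Bernstein's device. In a direction x_b other than x_1 the coefficients of the
    equation do not vary, d_b h is again a solution, and the maximum of (d_b h)^2 + c h^2 is
    examined. Along x_1 this commutation fails, but by then the equation has become the ordinary one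
    d_1 (phi d_1 h) = 0, settled by periodicity. Hence the choice of a phi that varies with one
    coordinate only. D is holomorphic because type (1,0) means w_(y_c) = 'i w_(x_c): applying Lap
    and using Lap w_b = d_b D gives d_(y_c) D = 'i d_(x_c) D. So the real and imaginary parts of D
    are harmonic, and the same Liouville theorem with phi = 1 serves for D and then for each w_b.
    The powers of phi come from the Hodge star, which in dimension 4 scales on k-forms by phi^(2 -
    k); it leaves 2-forms alone. *)

(** * Smooth functions on R^n *)

(* [partial] sealed: otherwise, failing conversion tests unfold it down to
   limits of filters. *)
HB.lock Definition pd (R : realType) (n : nat) (a : 'I_n)
  (f : 'rV[R]_n -> R) : 'rV[R]_n -> R := partial a f.

Lemma pdE (R : realType) (n : nat) : @pd R n = @partial R n.
Proof. by rewrite pd.unlock. Qed.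

Section Calculus.
Context {R : realType} {n : nat}.
Implicit Types (f g : 'rV[R]_n -> R) (y : 'rV[R]_n) (a b : 'I_n).

Local Notation e a := (delta_mx 0 a : 'rV[R]_n).

(** The restriction to a line through which one-variable theorems (mean value, extremum) are brought
    to R^n. *)
Lemma is_derive_line f y (v : 'rV[R]_n) (t : R) :
  derivable f (y + t *: v) v ->
  is_derive t 1 (fun s : R => f (y + s *: v)) ('D_v f (y + t *: v)).
Proof.
move=> df.
have E : (fun h : R => h^-1 *: (f (y + (h *: 1 + t) *: v) - f (y + t *: v))) =
         (fun h : R => h^-1 *: (f (h *: v + (y + t *: v)) - f (y + t *: v))).
  apply/funext => h; congr (_ *: (f _ - _)).
  by rewrite scalerDl addrCA [h *: 1]mulr1.
by apply: DeriveDef; [rewrite /derivable/= E|rewrite /derive/= E].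
Qed.

Lemma MVT_pos (g dg : R -> R) (s : R) : 0 < s ->
  (forall x : R, is_derive x 1 g (dg x)) ->
  exists2 c : R, 0 < c < s & g s - g 0 = dg c * s.
Proof.
move=> s0 dgx; have cg : {within `[0, s], continuous g}.
  by apply: derivable_within_continuous => x _; have [] := dgx x.
have [c] := MVT s0 (fun x _ => dgx x) cg.
by rewrite in_itv/= subr0 => cs ->; exists c.
Qed.

Lemma norm_basis_le1 a : `|e a| <= 1.
Proof.
rewrite [leLHS]/Num.Def.normr/= mx_normrE bigmax_le// => -[i j] _ /=.
by rewrite mxE; case: (_ && _); rewrite ?normr1 ?normr0.
Qed.

(* The mixed second difference of f, evaluated by the mean value theorem. *)
Lemma second_difference f y a b (s : R) : 0 < s ->
  (forall x, derivable f x (e a)) ->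
  (forall x, derivable (partial a f) x (e b)) ->
  exists2 x, `|x - y| <= s + s &
    f (y + s *: e a + s *: e b) - f (y + s *: e a) - f (y + s *: e b) + f y
    = partial b (partial a f) x * s * s.
Proof.
move=> s0 da dba.
pose g r := f (y + s *: e b + r *: e a) - f (y + r *: e a).
pose dg r := partial a f (y + s *: e b + r *: e a) - partial a f (y + r *: e a).
have [x|c /andP[c0 cs] Ec] := @MVT_pos g dg s s0.
  by apply: is_deriveB; exact: is_derive_line.
pose h r := partial a f (y + c *: e a + r *: e b).
have [x|d /andP[d0 ds] Ed] :=
    @MVT_pos h (fun r => partial b (partial a f) (y + c *: e a + r *: e b)) s s0.
  exact: is_derive_line.
exists (y + c *: e a + d *: e b).
  rewrite -[y + _ + _]addrA [y + _]addrC addrK (le_trans (ler_normD _ _))// lerD// normrZ.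
    by rewrite gtr0_norm// (le_trans _ (ltW cs))// ler_piMr ?norm_basis_le1// ltW.
  by rewrite gtr0_norm// (le_trans _ (ltW ds))// ler_piMr ?norm_basis_le1// ltW.
rewrite -Ed; move: Ec; rewrite /g /dg /h !scale0r !addr0.
rewrite [y + c *: _ + s *: _]addrAC [y + s *: e b + s *: _]addrAC => <-; ring.
Qed.

(** Made for Schwarz's theorem: the mean value theorem evaluates the two mixed derivatives at two
    different points, both as close to y as desired. *)
Lemma eq_of_near_values f g y :
  {for y, continuous f} -> {for y, continuous g} ->
  (forall s : R, 0 < s -> exists x1 x2,
    [/\ `|x1 - y| <= s + s, `|x2 - y| <= s + s & f x1 = g x2]) ->
  f y = g y.
Proof.
move=> cf cg H; apply/eqP; rewrite -subr_eq0 -normr_eq0 eq_le normr_ge0 andbT.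
apply/ler_addgt0Pr => eps eps0; rewrite add0r.
have e2 : 0 < eps / 2 by rewrite divr_gt0.
move/cvgrPdist_lt : cf => /(_ _ e2)/nbhs_ballP[r1 /= r10 H1].
move/cvgrPdist_lt : cg => /(_ _ e2)/nbhs_ballP[r2 /= r20 H2].
pose s := Num.min r1 r2 / 3.
have m0 : 0 < Num.min r1 r2 by rewrite lt_min r10.
have s0 : 0 < s by rewrite divr_gt0.
have ss : s + s < Num.min r1 r2 by rewrite /s; lra.
have [x1 [x2 [x1y x2y Ex]]] := H s s0.
rewrite -(subrKA (f x1)) (le_trans (ler_normD _ _))//.
rewrite [leRHS]splitr lerD// ltW//.
  apply: H1; rewrite mx_norm_ball /ball_/= distrC (le_lt_trans x1y)//.
  by rewrite (lt_le_trans ss)// ge_min lexx.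
rewrite Ex distrC; apply: H2; rewrite mx_norm_ball /ball_/= distrC.
by rewrite (le_lt_trans x2y)// (lt_le_trans ss)// ge_min lexx orbT.
Qed.

(** The mixed second difference is symmetric in a and b, and equals s^2 times either mixed
    derivative at points near y; s^2 cancels and s tends to 0. *)
Lemma partialC f y a b :
  (forall x, derivable f x (e a)) -> (forall x, derivable f x (e b)) ->
  (forall x, derivable (partial a f) x (e b)) ->
  (forall x, derivable (partial b f) x (e a)) ->
  {for y, continuous (partial b (partial a f))} ->
  {for y, continuous (partial a (partial b f))} ->
  partial b (partial a f) y = partial a (partial b f) y.
Proof.
move=> da db dba dab cba cab; apply: eq_of_near_values cba cab _ => s s0.
have [x1 x1y E1] := second_difference y s0 da dba.
have [x2 x2y E2] := second_difference y s0 db dab.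
exists x1, x2; split; [exact: x1y|exact: x2y|].
have E : partial b (partial a f) x1 * s * s = partial a (partial b f) x2 * s * s.
  apply: etrans (esym E1) _; apply: etrans _ E2.
  by rewrite [y + s *: e b + _]addrAC [X in X + _]addrAC.
move: (partial b _ x1) (partial a _ x2) E => u v /(mulIf (lt0r_neq0 s0)).
exact: (mulIf (lt0r_neq0 s0)).
Qed.

Lemma is_derive_partial f y a (t : R) :
  derivable f (y + t *: e a) (e a) ->
  is_derive t 1 (fun s : R => f (y + s *: e a)) (pd a f (y + t *: e a)).
Proof. by rewrite pdE; exact: is_derive_line. Qed.

(* Continuity is required at each order, since existence of the partial
   derivatives does not imply it. *)
Fixpoint Ck (k : nat) f : Prop :=
  (forall y, {for y, continuous f} /\ forall a, derivable f y (e a)) /\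
  if k is k'.+1 then forall a, Ck k' (pd a f) else True.

Definition Coo f := forall k, Ck k f.

(** [Ck] takes the innermost derivative first, that is, the last element of the list in [smooth];
    hence the induction from the end of the list. The recursive form suits the product rule. *)
Lemma CooP f : Coo f <-> smooth setT f.
Proof.
rewrite /smooth -pdE; split=> [cf s|].
  elim/last_ind: s f cf => [|s a IH] f cf /=.
    by move=> y _; exact: (cf 0%N).1.
  by rewrite foldr_rcons; apply: IH => k; exact: (cf k.+1).2.
move=> sf k; elim: k f sf => [|k IH] f sf /=.
  by split=> // y; apply: (sf [::]).
split=> [y|a]; first exact: (sf [::]).
by apply: IH => s /= y _; have := sf (rcons s a) y I; rewrite foldr_rcons.
Qed.

Lemma Coo_ext f g : f =1 g -> Coo f -> Coo g.
Proof. by move=> /funext ->. Qed.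

Lemma Coo_derivable f y a : Coo f -> derivable f y (e a).
Proof. by move=> /(_ 0%N)[/(_ y)[_]]. Qed.

Lemma Coo_continuous f : Coo f -> continuous f.
Proof. by move=> /(_ 0%N)[cf _] y; have [] := cf y. Qed.

Lemma Coo_partial f a : Coo f -> Coo (pd a f).
Proof. by move=> cf k; exact: (cf k.+1).2. Qed.

Lemma CkW k f : Ck k.+1 f -> Ck k f.
Proof.
elim: k f => [|k IH] f [c0 cS]; first by split.
by split=> // a; apply: IH; exact: cS.
Qed.

Lemma partial_cst (c : R) a : pd a (fun=> c) = fun=> 0.
Proof. by apply/funext => y; rewrite pdE /partial derive_cst. Qed.

Lemma Coo_cst (c : R) : Coo (fun=> c).
Proof.
move=> k; elim: k c => [|k IH] c /=; split=> //.
- by move=> y; split=> [|a]; [exact: cst_continuous|exact: derivable_cst].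
- by move=> y; split=> [|a]; [exact: cst_continuous|exact: derivable_cst].
- by move=> a; rewrite partial_cst; exact: IH.
Qed.

Lemma partialD f g a : (forall y, derivable f y (e a)) ->
  (forall y, derivable g y (e a)) ->
  pd a (fun y => f y + g y) = fun y => pd a f y + pd a g y.
Proof. by move=> df dg; apply/funext => y; rewrite pdE /partial deriveD. Qed.

Lemma partialM f g a : (forall y, derivable f y (e a)) ->
  (forall y, derivable g y (e a)) ->
  pd a (fun y => f y * g y) =
  fun y => pd a f y * g y + f y * pd a g y.
Proof.
move=> df dg; apply/funext => y.
by rewrite pdE /partial (deriveM (df y) (dg y)) addrC; congr (_ + _); exact: mulrC.
Qed.

Lemma Ck_derivable k f y a : Ck k f -> derivable f y (e a).
Proof. by case: k => [|k] [/(_ y)[]]. Qed.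

Lemma Ck_continuous k f y : Ck k f -> {for y, continuous f}.
Proof. by case: k => [|k] [/(_ y)[]]. Qed.

Lemma CkD k f g : Ck k f -> Ck k g -> Ck k (fun y => f y + g y).
Proof.
elim: k f g => [|k IH] f g cf cg /=.
all: split=> [y|]; first (split=> [|a];
  [apply: continuousD; apply: Ck_continuous; eassumption
  |apply: derivableD; apply: Ck_derivable; eassumption]).
- by [].
- move=> a; rewrite partialD; first by apply: IH; [exact: cf.2|exact: cg.2].
  + by move=> y; apply: Ck_derivable cf.
  + by move=> y; apply: Ck_derivable cg.
Qed.

Lemma CkM k f g : Ck k f -> Ck k g -> Ck k (fun y => f y * g y).
Proof.
elim: k f g => [|k IH] f g cf cg /=.
all: split=> [y|]; first (split=> [|a];
  [apply: continuousM; apply: Ck_continuous; eassumption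
  |apply: derivableM; apply: Ck_derivable; eassumption]).
- by [].
- move=> a; rewrite partialM.
  + apply: CkD; apply: IH; [exact: cf.2|exact: CkW|exact: CkW|exact: cg.2].
  + by move=> y; apply: Ck_derivable cf.
  + by move=> y; apply: Ck_derivable cg.
Qed.

Lemma CooD f g : Coo f -> Coo g -> Coo (fun y => f y + g y).
Proof. by move=> cf cg k; exact: CkD. Qed.

Lemma CooM f g : Coo f -> Coo g -> Coo (fun y => f y * g y).
Proof. by move=> cf cg k; exact: CkM. Qed.

Lemma CooZ (c : R) f : Coo f -> Coo (fun y => c * f y).
Proof. by apply: CooM; exact: Coo_cst. Qed.

Lemma CooN f : Coo f -> Coo (fun y => - f y).
Proof. by move=> /(CooZ (-1)); apply: Coo_ext => y; rewrite mulN1r. Qed.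

Lemma CooB f g : Coo f -> Coo g -> Coo (fun y => f y - g y).
Proof. by move=> cf /CooN; exact: CooD. Qed.

Lemma Coo_sum (I : Type) (r : seq I) (P : pred I) (F : I -> 'rV[R]_n -> R) :
  (forall i, Coo (F i)) -> Coo (fun y => \sum_(i <- r | P i) F i y).
Proof.
move=> cF; elim: r => [|i r IH].
  by apply: (@Coo_ext (fun=> 0)); [move=> y; rewrite big_nil|exact: Coo_cst].
have [Pi|nPi] := boolP (P i).
  apply: (@Coo_ext (fun y => F i y + \sum_(i <- r | P i) F i y)).
    by move=> y; rewrite big_cons Pi.
  exact: CooD.
apply: Coo_ext IH => y; by rewrite big_cons (negbTE nPi).
Qed.

Lemma partialV f a : (forall y, f y != 0) -> (forall y, derivable f y (e a)) ->
  pd a (fun y => (f y)^-1) =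
  fun y => (-1 * pd a f y) * ((f y)^-1 * (f y)^-1).
Proof.
move=> f0 df; apply/funext => y; rewrite pdE /partial deriveV//.
by rewrite /GRing.scale/= expr2 invfM mulN1r !mulNr mulrC.
Qed.

(** The derivative of 1/f is a polynomial in f' and 1/f, so order k for 1/f yields order k + 1. *)
Lemma CooV f : (forall y, f y != 0) -> Coo f -> Coo (fun y => (f y)^-1).
Proof.
move=> f0 cf k; elim: k => [|k IH] /=.
all: split=> [y|]; first (split=> [|a];
  [apply: continuousV => //; exact: Coo_continuous
  |apply: derivableV => //; exact: Coo_derivable]).
- by [].
- move=> a; rewrite partialV//; last by move=> y; exact: Coo_derivable.
  apply: CkM; last exact: CkM.
  by apply: CkM; [exact: Coo_cst|exact: Coo_partial].
Qed.

Lemma Coo_partialC f a b : Coo f ->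
  pd a (pd b f) = pd b (pd a f).
Proof.
move=> cf; apply/funext => y; rewrite pdE; apply: partialC; rewrite -?pdE;
  by do ?[move=> x; apply: Coo_derivable | apply: Coo_continuous];
  do ?apply: Coo_partial.
Qed.

Lemma partialZ (c : R) f a : Coo f ->
  pd a (fun y => c * f y) = fun y => c * pd a f y.
Proof. by move=> cf; apply/funext => y; rewrite pdE /partial deriveMl//; exact: Coo_derivable. Qed.

Lemma partialN f a : Coo f ->
  pd a (fun y => - f y) = fun y => - pd a f y.
Proof. by move=> cf; apply/funext => y; rewrite pdE /partial deriveN//; exact: Coo_derivable. Qed.

Lemma partial_sum (I : Type) (r : seq I) (P : pred I) (F : I -> 'rV[R]_n -> R) a :
  (forall i, Coo (F i)) ->
  pd a (fun y => \sum_(i <- r | P i) F i y) =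
  fun y => \sum_(i <- r | P i) pd a (F i) y.
Proof.
move=> cF; elim: r => [|i r IH].
  rewrite [X in pd a X](_ : _ = fun=> 0); last first.
    by apply/funext => y; rewrite big_nil.
  by rewrite partial_cst; apply/funext => y; rewrite big_nil.
case Pi : (P i); last first.
  rewrite [X in pd a X](_ : _ = fun y => \sum_(j <- r | P j) F j y).
    by rewrite IH; apply/funext => y; rewrite big_cons Pi.
  by apply/funext => y; rewrite big_cons Pi.
rewrite [X in pd a X](_ : _ = fun y => F i y + \sum_(j <- r | P j) F j y).
  rewrite partialD; last 2 first.
  - by move=> y; apply: Coo_derivable.
  - by move=> y; apply: Coo_derivable; exact: Coo_sum.
  by rewrite IH; apply/funext => y; rewrite big_cons Pi.
by apply/funext => y; rewrite big_cons Pi.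
Qed.

Lemma partial_near f g a y : (\near y, f y = g y) -> partial a f y = partial a g y.
Proof. exact: near_eq_derive. Qed.

Lemma foldr_partial_near f g (s : seq 'I_n) y : (\near y, f y = g y) ->
  \near y, foldr (@partial R n) f s y = foldr (@partial R n) g s y.
Proof.
move=> fg; elim: s => //= a s IH.
by apply: filterS (nbhs_interior IH) => z; exact: partial_near.
Qed.

(** Iterated partial derivatives depend on the germ only. The model g may change with the point, as
    happens for maps read in charts. *)
Lemma smooth_near (U V : set 'rV[R]_n) f :
  (forall y, U y -> exists2 g, smooth V g & V y /\ \near y, f y = g y) ->
  smooth U f.
Proof.
move=> H s h y /H[g sg [Vy fg]]; have [cg dg] := sg s y Vy.
have hg := foldr_partial_near s fg.
split=> [|a].
  rewrite /h /prop_for /continuous_at (nbhs_singleton hg); move: cg.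
  apply: cvg_trans; apply: (near_eq_cvg (F := nbhs y)).
  by near=> z; rewrite (near hg z).
by apply: near_eq_derivable (dg a); near=> z; rewrite /h (near hg z).
Unshelve. all: by end_near. Qed.

End Calculus.

(** * A Liouville theorem for periodic functions *)

Definition lattice_vector (R : realType) (n : nat) (v : 'rV[R]_n) : Prop :=
  forall i, v 0 i \is a Num.int.

Definition lattice_periodic (R : realType) (n : nat) (T : Type)
    (f : 'rV[R]_n -> T) : Prop :=
  forall y v, lattice_vector v -> f (y + v) = f y.

Section MaximumPrinciple.
Context {R : realType} {n : nat}.
Implicit Types (f g h w : 'rV[R]_n -> R) (y : 'rV[R]_n) (a b : 'I_n).

Local Notation e a := (delta_mx 0 a : 'rV[R]_n).

Lemma lattice_vector_basis a : lattice_vector (e a).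
Proof. by move=> i; rewrite mxE; case: (_ && _); rewrite ?rpred0 ?rpred1. Qed.

Lemma lattice_periodic_partial f a :
  lattice_periodic f -> lattice_periodic (pd a f).
Proof.
move=> pf y v lv; rewrite pdE /partial /derive.
suff -> : (fun r : R => r^-1 *: ((f \o shift (y + v)) (r *: e a) - f (y + v))) =
          (fun r : R => r^-1 *: ((f \o shift y) (r *: e a) - f y)) by [].
apply/funext => r /=; rewrite addrA. by rewrite !(pf _ _ lv).
Qed.

Lemma lattice_fundamental_domain y :
  exists2 v, lattice_vector v & forall i, 0 <= (y + v) 0 i <= 1.
Proof.
exists (\row_i - (Num.floor (y 0 i))%:~R) => i.
  by rewrite mxE rpredN intr_int.
rewrite !mxE subr_ge0 lerBlDr.
by rewrite floor_le /= ltW// -[X in X + _]/(1%:~R) addrC -intrD floorD1_gt.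
Qed.

Lemma lattice_periodic_max f : continuous f -> lattice_periodic f ->
  exists q, forall x, f x <= f q.
Proof.
move=> cf pf; pose K := [set v : 'rV[R]_n | forall i, `[0, 1]%classic (v ord0 i)].
have cK : compact K.
  exact: (@rV_compact R n (fun=> `[0, 1]%classic) (fun=> @segment_compact R 0 1)).
have K0 : K !=set0.
  by exists 0 => i /=; rewrite mxE in_itv/= lexx ler01.
have [q _ Hq] := EVT_max_rV K0 cK (continuous_subspaceT cf).
exists q => x; have [v lv Kv] := lattice_fundamental_domain x.
rewrite -(pf x v lv); apply: Hq; rewrite inE => i /=.
by rewrite in_itv; exact: Kv.
Qed.

(** If d2 were positive, dg would be positive just to the right of 0, and the mean value theorem
    would give g (r/2) > g 0. *)
Lemma derive2_at_max (g dg : R -> R) (d2 : R) :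
  (forall x : R, is_derive x 1 g (dg x)) -> is_derive (0 : R) 1 dg d2 ->
  (forall x, g x <= g 0) -> dg 0 = 0 /\ d2 <= 0.
Proof.
move=> Hg Hdg gmax.
have dg0 : dg 0 = 0.
  have H : is_derive (0 : R) 1 g 0.
    apply: (@derive1_at_max _ g (-1) 1) => //.
    by rewrite in_itv/=; lra.
  by case: (Hg 0) => _ <-; case: H.
split=> //; rewrite leNgt; apply/negP => d20.
have [/cvg_ex[l lE] El] := Hdg.
have {El}El : l = d2 by rewrite -El; exact/esym/cvg_lim.
rewrite {l}El in lE.
move/cvgrPdist_lt : lE => /(_ _ d20)[r /= r0 Hr].
have dgpos x : 0 < x < r -> 0 < dg x.
  move=> /andP[x0 xr]; have := Hr x; rewrite /ball_/= sub0r normrN gtr0_norm//.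
  move=> /(_ xr (lt0r_neq0 x0)); rewrite [x *: 1]mulr1 addr0 dg0 subr0.
  move=> /ltr_normlP[_]; rewrite ltrBlDr -ltrBlDl subrr.
  by rewrite pmulr_rgt0// invr_gt0.
have r2 : 0 < r / 2 by rewrite divr_gt0.
have [c /andP[c0 cr] Ec] := MVT_pos r2 Hg.
have : 0 < dg c * (r / 2).
  by rewrite mulr_gt0// dgpos// c0 (lt_trans cr)// ltr_pdivrMr// ltr_pMr// ltr1n.
by rewrite -Ec subr_gt0 ltNge gmax.
Qed.

Lemma partial_at_max f q a : Coo f -> (forall x, f x <= f q) ->
  pd a f q = 0 /\ pd a (pd a f) q <= 0.
Proof.
move=> cf fq.
have H := @derive2_at_max (fun t => f (q + t *: e a))
  (fun t => pd a f (q + t *: e a)) (pd a (pd a f) q).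
move: H; rewrite scale0r addr0; apply.
- by move=> x; apply: is_derive_partial; exact: Coo_derivable.
- have := @is_derive_partial _ _ (pd a f) q a 0.
  by rewrite scale0r addr0; apply; apply/Coo_derivable/Coo_partial.
- by move=> x; exact: fq.
Qed.

(* phi times the Laplacian of the metric phi^-1 |dx|^2, in the case where phi
   depends on the coordinate k alone. *)
Definition ell (phi : 'rV[R]_n -> R) (k : 'I_n) w y : R :=
  phi y * \sum_b pd b (pd b w) y + pd k phi y * pd k w y.

Lemma partial_sqr w b : Coo w ->
  pd b (fun y => w y * w y) = fun y => 2 * (w y * pd b w y).
Proof.
move=> cw; rewrite partialM; try by move=> y; exact: Coo_derivable.
by apply/funext => y; ring.
Qed.

Lemma partial2_sqr w b : Coo w ->
  pd b (pd b (fun y => w y * w y)) =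
  fun y => 2 * (pd b w y * pd b w y + w y * pd b (pd b w) y).
Proof.
move=> cw; rewrite partial_sqr// partialZ; last first.
  by apply: CooM => //; exact: Coo_partial.
rewrite partialM; try by move=> y; do ?apply: Coo_derivable; do ?apply: Coo_partial.
by [].
Qed.

(** From L (w^2) = 2 w L w + 2 phi |dw|^2: on squares of solutions L is nonnegative, against
    [ell_max_le0] unless the gradient vanishes at the maximum. *)
Lemma ell_sqr phi k w y : Coo w -> ell phi k w y = 0 ->
  ell phi k (fun y => w y * w y) y =
  2 * (phi y * \sum_b pd b w y * pd b w y).
Proof.
move=> cw; rewrite /ell partial_sqr//.
under [in X in _ -> X]eq_bigr do rewrite partial2_sqr//.
rewrite -mulr_sumr big_split/= -mulr_sumr.
move: (\sum_b _) (\sum_b _) (pd k w y) (pd k phi y) => s2 s1 p1 p2 H.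
have -> : phi y * (2 * (s2 + w y * s1)) + p2 * (2 * (w y * p1)) =
    2 * (phi y * s2) + 2 * (w y * (phi y * s1 + p2 * p1)) by ring.
by rewrite H !mulr0 addr0.
Qed.

Lemma ell_add phi k (c : R) w u y : Coo w -> Coo u ->
  ell phi k (fun y => w y + c * u y) y = ell phi k w y + c * ell phi k u y.
Proof.
move=> cw cu; rewrite /ell.
have P b w' u' : Coo w' -> Coo u' -> pd b (fun y => w' y + c * u' y) =
    fun y => pd b w' y + c * pd b u' y.
  move=> cw' cu'; rewrite partialD.
  - by rewrite partialZ.
  - by move=> z; exact: Coo_derivable.
  - by move=> z; apply: Coo_derivable; exact: CooZ.
have Q b : pd b (pd b (fun y => w y + c * u y)) y =
    pd b (pd b w) y + c * pd b (pd b u) y.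
  by rewrite (P b w u cw cu) (P b _ _ (Coo_partial b cw) (Coo_partial b cu)).
rewrite (P k w u cw cu).
have -> : \sum_b pd b (pd b (fun y => w y + c * u y)) y =
    \sum_b pd b (pd b w) y + c * \sum_b pd b (pd b u) y.
  by rewrite mulr_sumr -big_split; apply: eq_bigr => b _; exact: Q.
move: (\sum_b _) (\sum_b _) (pd k w y) (pd k u y) (pd k phi y).
by move=> s1 s2 p1 p2 p3; ring.
Qed.

Lemma ell_max_le0 phi k w q : 0 <= phi q -> Coo w -> (forall x, w x <= w q) ->
  ell phi k w q <= 0.
Proof.
move=> p0 cw wq; rewrite /ell (partial_at_max k cw wq).1 mulr0 addr0.
by rewrite mulr_ge0_le0// sumr_le0// => b _; exact: (partial_at_max b cw wq).2.
Qed.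

(* At a maximum of w^2 + c u^2, where w and u are solutions, the left hand side
   of L (w^2 + c u^2) = 2 phi (|dw|^2 + c |du|^2) is nonpositive.  With w = d_b h,
   u = h and c tending to 0, this bounds d_b h by 0. *)
Lemma ell_grad_zero phi k (w u : 'rV[R]_n -> R) (c : R) :
  (forall y, 0 < phi y) -> Coo w -> Coo u ->
  lattice_periodic w -> lattice_periodic u ->
  (forall y, ell phi k w y = 0) -> (forall y, ell phi k u y = 0) -> 0 < c ->
  exists2 q, forall x, w x * w x + c * (u x * u x) <= w q * w q + c * (u q * u q)
    & forall b, pd b u q = 0.
Proof.
move=> p0 cw cu pw pu ew eu c0.
pose F x := w x * w x + c * (u x * u x).
have cF : Coo F by apply: CooD; [exact: CooM|apply: CooZ; exact: CooM].
have pF : lattice_periodic F by move=> y v lv; rewrite /F pw// pu.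
have [q Fq] := lattice_periodic_max (Coo_continuous cF) pF.
exists q => // b.
have := ell_max_le0 k (ltW (p0 q)) cF Fq.
rewrite ell_add ?ell_sqr//; try exact: CooM.
have S0 (v : 'rV[R]_n -> R) : 0 <= \sum_b pd b v q * pd b v q.
  by rewrite sumr_ge0// => i _; rewrite -expr2 sqr_ge0.
have H (v : 'rV[R]_n -> R) : 0 <= 2 * (phi q * \sum_b pd b v q * pd b v q).
  by rewrite mulr_ge0// mulr_ge0// ltW.
move=> Hle.
have : 2 * (phi q * \sum_b pd b u q * pd b u q) = 0.
  apply/eqP; rewrite eq_le H andbT -(ler_pM2l c0) mulr0.
  by apply: le_trans Hle; rewrite lerDr.
move=> /eqP; rewrite !mulf_eq0 pnatr_eq0/= (negbTE (lt0r_neq0 (p0 q)))/=.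
rewrite psumr_eq0; last by move=> i _; rewrite -expr2 sqr_ge0.
by move=> /allP/(_ b (mem_index_enum _)); rewrite mulf_eq0 orbb => /eqP.
Qed.

(** The coefficients phi and d_k phi are constant along x_b, so the operator commutes with d_b. *)
Lemma ell_partial phi k b w : Coo phi -> Coo w ->
  pd b phi = (fun=> 0) -> (forall y, ell phi k w y = 0) ->
  forall y, ell phi k (pd b w) y = 0.
Proof.
move=> cp cw pb ew y.
have cS : Coo (fun y => \sum_b pd b (pd b w) y).
  by apply: Coo_sum => i; do 2!apply: Coo_partial.
have : pd b (ell phi k w) y = 0.
  have -> : ell phi k w = (fun=> 0) by apply/funext.
  by rewrite partial_cst.
rewrite /ell partialD; first last.
- by move=> z; apply: Coo_derivable; apply: CooM; exact: Coo_partial.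
- by move=> z; apply: Coo_derivable; exact: CooM.
rewrite !partialM; try by move=> z; do ?apply: Coo_derivable => //; do ?apply: Coo_partial.
rewrite (Coo_partialC b k cp) pb partial_cst !mul0r !add0r => H.
rewrite -[RHS]H; congr (_ + _).
  congr (_ * _); rewrite partial_sum/=; last by move=> i; do 2!apply: Coo_partial.
  apply: eq_bigr => i _.
  rewrite (Coo_partialC i b cw) (Coo_partialC i b)//; exact: Coo_partial.
by rewrite (Coo_partialC k b).
Qed.

Lemma line_constant f a : Coo f -> (forall y, pd a f y = 0) ->
  forall y t, f (y + t *: e a) = f y.
Proof.
move=> cf f0 y.
have H (y' : 'rV[R]_n) (t : R) : 0 < t -> f (y' + t *: e a) = f y'.
  move=> t0; have [x|c _] := MVT_pos (g := fun t => f (y' + t *: e a))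
      (dg := fun t => pd a f (y' + t *: e a)) t0.
    by apply: is_derive_partial; exact: Coo_derivable.
  by rewrite f0 mul0r scale0r addr0 => /eqP; rewrite subr_eq0 => /eqP.
move=> t; have [t0|t0|<-] := ltgtP 0 t; first exact: H.
- by have := H (y + t *: e a) (- t); rewrite oppr_gt0 scaleNr addrK => /(_ t0).
- by rewrite scale0r addr0.
Qed.

Lemma constant_of_partial f : Coo f -> (forall a y, pd a f y = 0) ->
  forall y, f y = f 0.
Proof.
move=> cf f0 y; rewrite (row_sum_delta y).
elim/big_rec: _ => //= i x _ <-.
by rewrite addrC line_constant.
Qed.

(** For b other than k, [ell_grad_zero] applied to d_b h and h bounds (d_b h)^2 by c max h^2, at a
    point where the gradient of h vanishes; c is arbitrary. The direction k is left with an ordinary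
    differential equation. *)
Lemma liouville phi h k : Coo phi -> Coo h -> lattice_periodic h ->
  (forall y, 0 < phi y) -> (forall b, b != k -> pd b phi = fun=> 0) ->
  (forall y, \sum_b pd b (fun x => phi x * pd b h x) y = 0) ->
  forall b y, pd b h y = 0.
Proof.
move=> cp ch ph p0 pk Hdiv.
have eh y : ell phi k h y = 0.
  rewrite /ell -[RHS](Hdiv y).
  under [RHS]eq_bigr => b _.
    rewrite partialM; last 2 first.
    + by move=> z; exact: Coo_derivable.
    + by move=> z; apply: Coo_derivable; exact: Coo_partial.
    over.
  rewrite big_split/= [RHS]addrC mulr_sumr; congr (_ + _).
  rewrite (bigD1 k)//= big1 ?addr0// => b bk.
  by rewrite pk// mul0r.
have Hb b : b != k -> forall y, pd b h y = 0.
  move=> bk y.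
  have [q0 Hq0] : exists q, forall x, h x * h x <= h q * h q.
    apply: (@lattice_periodic_max (fun x => h x * h x)).
      by apply: Coo_continuous; exact: CooM.
    by move=> x v lv; rewrite ph.
  apply/eqP; rewrite -sqrf_eq0 eq_le sqr_ge0 andbT.
  apply/ler_addgt0Pr => eps eps0; rewrite add0r.
  have M0 : 0 <= h q0 * h q0 by rewrite -expr2 sqr_ge0.
  (* Chosen for c max h^2 <= eps; the summand 1 keeps the denominator positive. *)
  pose c := eps / (h q0 * h q0 + 1).
  have c0 : 0 < c by rewrite divr_gt0// ltr_wpDl.
  have [q Hq gq] := ell_grad_zero p0 (Coo_partial b ch) ch
    (lattice_periodic_partial b ph) ph (ell_partial cp ch (pk b bk) eh) eh c0.
  have := Hq y; rewrite gq mulr0 add0r => H.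
  have h1 : 0 <= c * (h y * h y) by rewrite mulr_ge0 ?(ltW c0)// -expr2 sqr_ge0.
  have h2 : c * (h q * h q) <= c * (h q0 * h q0) by rewrite ler_pM2l.
  have h3 : c * (h q0 * h q0) <= eps.
    by rewrite /c mulrAC ler_pdivrMr ?ltr_wpDl// ler_pM2l// lerDl.
  rewrite expr2; lra.
move=> b y; have [->|] := eqVneq b k; last by move=> /Hb.
pose W x := phi x * pd k h x.
have cW : Coo W by apply: CooM => //; exact: Coo_partial.
(* The other derivatives of h being zero, only the k-th term of the divergence remains. *)
have W0 x : pd k W x = 0.
  have := Hdiv x; rewrite (bigD1 k)//= big1 ?addr0// => c ck.
  have -> : (fun x => phi x * pd c h x) = fun=> 0.
    by apply/funext => z; rewrite Hb// mulr0.
  by rewrite partial_cst.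
(* phi d_k h is constant along the k-th coordinate lines and, by Rolle's theorem
   over one period, vanishes somewhere on each of them. *)
have [x|c _] := MVT_pos (g := fun t => h (y + t *: e k))
      (dg := fun t => pd k h (y + t *: e k)) (@ltr01 R).
  by apply: is_derive_partial; exact: Coo_derivable.
rewrite scale1r scale0r addr0 ph; last exact: lattice_vector_basis.
rewrite subrr mulr1 => /esym Ec.
have := line_constant cW W0 y c; rewrite /W Ec mulr0 => /esym/eqP.
by rewrite mulf_eq0 (negbTE (lt0r_neq0 (p0 y)))/= => /eqP.
Qed.

End MaximumPrinciple.

(** * The Levi-Civita symbol in dimension 4 *)

Section Determinant.
Context {T : comNzRingType}.

Lemma det_mx22 (A : 'M[T]_2) : \det A = A 0 0 * A 1 1 - A 0 1 * A 1 0.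
Proof.
rewrite (expand_det_row _ 0) !big_ord_recl big_ord0 /cofactor !det_mx11 !mxE /=.
rewrite (_ : lift 0 0 = 1); last exact: val_inj.
rewrite (_ : lift 1 0 = 0); last exact: val_inj.
by rewrite expr0 expr1 mul1r addr0 mulN1r mulrN.
Qed.

Lemma det_mx33 (A : 'M[T]_3) : let a i j := A (inord i) (inord j) in
  \det A = a 0 0 * (a 1 1 * a 2 2 - a 1 2 * a 2 1)
         - a 0 1 * (a 1 0 * a 2 2 - a 1 2 * a 2 0)
         + a 0 2 * (a 1 0 * a 2 1 - a 1 1 * a 2 0).
Proof.
move=> a; pose b (i j : 'I_3) := a i j.
have E i j : A i j = b i j by rewrite /b /a !inord_val.
rewrite (expand_det_row _ 0) !big_ord_recl big_ord0 /cofactor !det_mx22 !mxE !E /b /=.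
by rewrite /bump /=; ring.
Qed.

(** Expansion along the first row: m i j k is the minor of the last three rows in the columns i, j,
    k. Natural number indices make it match the body of [eps4]. *)
Lemma det_mx44 (A : 'M[T]_4) : let a i j := A (inord i) (inord j) in
  let m i j k := a 1 i * (a 2 j * a 3 k - a 2 k * a 3 j)
               - a 1 j * (a 2 i * a 3 k - a 2 k * a 3 i)
               + a 1 k * (a 2 i * a 3 j - a 2 j * a 3 i) in
  \det A = a 0 0 * m 1 2 3 - a 0 1 * m 0 2 3 + a 0 2 * m 0 1 3 - a 0 3 * m 0 1 2.
Proof.
move=> a m; pose b (i j : 'I_4) := a i j.
have E i j : A i j = b i j by rewrite /b /a !inord_val.
rewrite (expand_det_row _ 0) !big_ord_recl big_ord0 /cofactor !det_mx33 !mxE !E /b /=.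
rewrite !inordK// /bump /= /m; ring.
Qed.

End Determinant.

Section LeviCivita.
Context {R : realType}.

(** The Levi-Civita symbol as a determinant of Kronecker deltas, expanded over integers: a form on
    which both [ring] and [vm_compute] work. *)
Definition eps4 (a b c d : nat) : int :=
  let D x i : int := (x == i)%:R in
  let m i j k := D b i * (D c j * D d k - D c k * D d j)
               - D b j * (D c i * D d k - D c k * D d i)
               + D b k * (D c i * D d j - D c j * D d i) in
  D a 0 * m 1 2 3 - D a 1 * m 0 2 3 + D a 2 * m 0 1 3 - D a 3 * m 0 1 2.

Lemma levi_civita4 (a b c d : 'I_4) :
  levi_civita R [:: a; b; c; d] = (eps4 a b c d)%:~R.
Proof.
rewrite /levi_civita det_mx44 !mxE !inordK//= /eps4.
by rewrite !(rmorphB, rmorphD, rmorphM) /= !rmorph_nat.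
Qed.

(** Antisymmetry is a polynomial identity in the deltas. The three adjacent transpositions generate
    all the sign changes used below. *)
Lemma eps4C12 a b c d : eps4 b a c d = - eps4 a b c d.
Proof. by rewrite /eps4; ring. Qed.

Lemma eps4C23 a b c d : eps4 a c b d = - eps4 a b c d.
Proof. by rewrite /eps4; ring. Qed.

Lemma eps4C34 a b c d : eps4 a b d c = - eps4 a b c d.
Proof. by rewrite /eps4; ring. Qed.

Lemma sum_ord4 (V : nmodType) (F : nat -> V) :
  \sum_(a < 4) F a = F 0 + F 1 + F 2 + F 3.
Proof. by rewrite !big_ord_recl big_ord0 addr0 !addrA. Qed.

(** 6 = 3! counts the orderings of the contracted indices. *)
Lemma eps4_contract3 (p a : 'I_4) :
  \sum_(q < 4) \sum_(r < 4) \sum_(s < 4) eps4 p q r s * eps4 a q r s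
  = 6 * (p == a)%:R.
Proof.
pose F q r s := eps4 p q r s * eps4 a q r s.
pose G q r := F q r 0%N + F q r 1%N + F q r 2 + F q r 3.
(* The sums are unrolled so that each of the 16 choices of p and a is a closed integer identity for
   [vm_compute]. *)
under eq_bigr => q _.
  under eq_bigr => r _ do rewrite (sum_ord4 (F q r)).
  rewrite (sum_ord4 (G q)); over.
rewrite (sum_ord4 (fun q => G q 0%N + G q 1%N + G q 2 + G q 3)) -val_eqE {}/G {}/F.
by move: p a => [[|[|[|[|//]]]] ?] [[|[|[|[|//]]]] ?]; vm_compute.
Qed.

(** Moving s across q and r is an even permutation, so this is the usual contraction of eps_(p s q
    r) with eps_(a b q r); 2 = 2! orders q and r. *)
Lemma eps4_contract2 (p s a b : 'I_4) :
  \sum_(q < 4) \sum_(r < 4) eps4 p q r s * eps4 a b q r =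
  2 * ((p == a)%:R * (s == b)%:R - (p == b)%:R * (s == a)%:R).
Proof.
pose F q r := eps4 p q r s * eps4 a b q r.
under eq_bigr => q _ do rewrite (sum_ord4 (F q)).
rewrite (sum_ord4 (fun q => F q 0%N + F q 1%N + F q 2 + F q 3)) -!val_eqE {}/F.
by move: p s a b => [[|[|[|[|//]]]] ?] [[|[|[|[|//]]]] ?]
  [[|[|[|[|//]]]] ?] [[|[|[|[|//]]]] ?]; vm_compute.
Qed.

End LeviCivita.

(** * Real Hodge operators *)

Section RealHodge.
Context {R : realType}.
Local Open Scope complex_scope.

(* The complex Hodge operators act separately on real and imaginary parts; these
   are their real counterparts. *)
Definition rform n k : Type := k.-tuple 'I_n -> 'rV[R]_n -> R.

Definition rext_d n k (u : rform n k) : rform n k.+1 := fun t y =>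
  \sum_(j < k.+1)
    (-1) ^+ j * pd (tnth t j) (u [tuple tnth t (lift j l) | l < k]) y.

Definition rstar n k m (g : 'rV[R]_n -> 'M[R]_n) (u : rform n k) : rform n m :=
  fun s y => \sum_(a : k.-tuple 'I_n) \sum_(b : k.-tuple 'I_n)
    (k`!%:R^-1 * Num.sqrt (\det (g y)) * levi_civita R (a ++ s)
      * \prod_(l < k) invmx (g y) (tnth a l) (tnth b l)) * u b y.

Definition rcodiff n k (g : 'rV[R]_n -> 'M[R]_n) (u : rform n k.+1) :
    rform n k := fun t y => (-1) ^+ (n * k.+2).+1
    * rstar g (rext_d (rstar (m := n - k.+1) g u)) t y.

Definition rlaplacian n k (g : 'rV[R]_n -> 'M[R]_n) (u : rform n k.+1) :
    rform n k.+1 := fun t y => rext_d (rcodiff g u) t y + rcodiff g (rext_d u) t y.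

(** What [Re] and [Im] share. The metric is real, so all coefficients of the Hodge operators are,
    and such a P passes through each of them. *)
Definition Rlinear_part (P : R[i] -> R) : Prop :=
  [/\ forall x y, P (x + y) = P x + P y,
      forall r z, P (r%:C * z) = r * P z &
      forall n (a : 'I_n) f y, P (cpartial a f y) = pd a (fun x => P (f x)) y].

Lemma Re_Rlinear_part : Rlinear_part (@complex.Re R).
Proof.
split=> [[? ?] [? ?]|r [x y]|n a f y] //=; last by rewrite pdE.
by rewrite mul0r subr0.
Qed.

Lemma Im_Rlinear_part : Rlinear_part (@complex.Im R).
Proof.
split=> [[? ?] [? ?]|r [x y]|n a f y] //=; last by rewrite pdE.
by rewrite mul0r addr0.
Qed.

Section Part.
Variables (P : R[i] -> R) (HP : Rlinear_part P) (n : nat).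

Lemma Rlinear_part_sum (I : finType) (F : I -> R[i]) :
  P (\sum_i F i) = \sum_i P (F i).
Proof.
have [PD PZ _] := HP.
by apply: big_morph => //; have := PZ 0 0; rewrite mulr0 mul0r.
Qed.

Lemma Rlinear_part_sign j z : P ((-1) ^+ j * z) = (-1) ^+ j * P z.
Proof. by have [_ PZ _] := HP; rewrite -PZ rmorphXn rmorphN rmorph1. Qed.

Lemma Rlinear_part_ext_d k (w : local_form R n k) t y :
  P (ext_d w t y) = rext_d (fun t y => P (w t y)) t y.
Proof.
have [_ _ Pd] := HP; rewrite /ext_d Rlinear_part_sum; apply: eq_bigr => j _.
by rewrite Rlinear_part_sign Pd.
Qed.

Lemma Rlinear_part_star k m g (w : local_form R n k) (s : m.-tuple 'I_n) y :
  P (hodge_star g w s y) = rstar g (fun t y => P (w t y)) s y.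
Proof.
have [_ PZ _] := HP; rewrite /hodge_star Rlinear_part_sum; apply: eq_bigr => a _.
by rewrite Rlinear_part_sum; apply: eq_bigr => b _; rewrite PZ.
Qed.

Lemma Rlinear_part_codiff k g (w : local_form R n k.+1) t y :
  P (codiff g w t y) = rcodiff g (fun t y => P (w t y)) t y.
Proof.
rewrite /codiff Rlinear_part_sign Rlinear_part_star /rcodiff; congr (_ * _).
congr rstar; apply/funext => t'; apply/funext => y'.
rewrite Rlinear_part_ext_d; congr rext_d.
by apply/funext => t''; apply/funext => y''; exact: Rlinear_part_star.
Qed.

Lemma Rlinear_part_laplacian k g (w : local_form R n k.+1) t y :
  P (laplacian g w t y) = rlaplacian g (fun t y => P (w t y)) t y.
Proof.
have [PD _ _] := HP; rewrite /laplacian PD Rlinear_part_ext_d Rlinear_part_codiff.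
congr (_ + _).
  congr rext_d; apply/funext => t'; apply/funext => y'.
  exact: Rlinear_part_codiff.
congr rcodiff; apply/funext => t'; apply/funext => y'.
exact: Rlinear_part_ext_d.
Qed.

End Part.

Lemma sum_tuple0 (T : finType) (V : nmodType) (F : 0.-tuple T -> V) :
  \sum_t F t = F [tuple].
Proof. by rewrite (big_pred1 [tuple])// => t; apply/esym/eqP; exact: tuple0. Qed.

Lemma sum_tupleS (T : finType) (V : nmodType) k (F : k.+1.-tuple T -> V) :
  \sum_t F t = \sum_x \sum_(t : k.-tuple T) F [tuple of x :: t].
Proof.
rewrite pair_bigA/= (reindex (fun p : T * k.-tuple T => [tuple of p.1 :: p.2]))//=.
exists (fun t => (thead t, [tuple of behead t])) => [[x t]|t] _ /=.
  by congr pair; apply: val_inj.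
by rewrite -tuple_eta.
Qed.

(** The inverse metric is diagonal: a term with b <> a has a zero factor at an index where they
    differ. The weight amounts to phi^(n/2 - k). *)
Lemma rstar_conformal n k m (phi : 'rV[R]_n -> R) (u : rform n k)
    (s : m.-tuple 'I_n) y :
  rstar (fun y => (phi y)%:M) u s y =
  k`!%:R^-1 * Num.sqrt (phi y ^+ n) * (phi y)^-1 ^+ k
    * \sum_(a : k.-tuple 'I_n) levi_civita R (a ++ s) * u a y.
Proof.
rewrite /rstar mulr_sumr; apply: eq_bigr => a _.
rewrite (bigD1 a)//= [X in _ + X]big1 ?addr0; last first.
  move=> b ba; have [l /eqP lab] : exists l, tnth a l != tnth b l.
    apply/existsP; rewrite -negb_forall; apply: contra ba => /forallP H.
    by apply/eqP/eq_from_tnth => l; apply/esym/eqP.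
  rewrite (bigD1 l)//= invmx_scalar mxE (negbTE (introN eqP lab)) mulr0n.
  by rewrite mul0r mulr0 mul0r.
rewrite det_scalar; under eq_bigr do rewrite invmx_scalar mxE eqxx mulr1n.
by rewrite prodr_const card_ord; ring.
Qed.

End RealHodge.

(** * The codifferential of a conformally flat metric in dimension 4 *)

Section HodgeDim4.
Context {R : realType}.
Local Notation rform := (@rform R).

Lemma sum_tuple1 (T : finType) (V : nmodType) (F : 1.-tuple T -> V) :
  \sum_t F t = \sum_p F [tuple p].
Proof.
rewrite sum_tupleS; apply: eq_bigr => p _.
by rewrite sum_tuple0; congr F; apply: val_inj.
Qed.

Lemma sum_tuple2 (T : finType) (V : nmodType) (F : 2.-tuple T -> V) :
  \sum_t F t = \sum_p \sum_q F [tuple p; q].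
Proof.
rewrite sum_tupleS; apply: eq_bigr => p _; rewrite sum_tuple1.
by apply: eq_bigr => q _; congr F; apply: val_inj.
Qed.

Lemma sum_tuple3 (T : finType) (V : nmodType) (F : 3.-tuple T -> V) :
  \sum_t F t = \sum_p \sum_q \sum_r F [tuple p; q; r].
Proof.
rewrite sum_tupleS; apply: eq_bigr => p _; rewrite sum_tuple2.
by apply: eq_bigr => q _; apply: eq_bigr => r _; congr F; apply: val_inj.
Qed.

Lemma sum_tuple4 (T : finType) (V : nmodType) (F : 4.-tuple T -> V) :
  \sum_t F t = \sum_p \sum_q \sum_r \sum_s F [tuple p; q; r; s].
Proof.
rewrite sum_tupleS; apply: eq_bigr => p _; rewrite sum_tuple3.
by do 3!apply: eq_bigr => ? _; congr F; apply: val_inj.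
Qed.

Lemma tuple1_eta n (t : 1.-tuple 'I_n) : t = [tuple tnth t ord0].
Proof. by apply: eq_from_tnth => i; rewrite (ord1 i). Qed.

Lemma rext_d0 n (u : rform n 0) p y :
  rext_d u [tuple p] y = pd p (u [tuple]) y.
Proof.
rewrite /rext_d !big_ord_recl big_ord0 /= expr0 mul1r addr0.
by congr (pd _ (u _) _); apply: eq_from_tnth => -[].
Qed.

Lemma rext_d1 n (u : rform n 1) p q y :
  rext_d u [tuple p; q] y = pd p (u [tuple q]) y - pd q (u [tuple p]) y.
Proof.
rewrite /rext_d !big_ord_recl big_ord0 /= !expr0 !exprS mulr1 mul1r mulN1r addr0.
congr (pd _ (u _) _ - pd _ (u _) _);
  by apply: eq_from_tnth => -[[|[|]]//= ?]; rewrite tnth_mktuple.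
Qed.

Lemma rext_d2 n (u : rform n 2) p q r y :
  rext_d u [tuple p; q; r] y =
  pd p (u [tuple q; r]) y - pd q (u [tuple p; r]) y + pd r (u [tuple p; q]) y.
Proof.
rewrite /rext_d !big_ord_recl big_ord0 /= !expr0 !exprS !expr0.
rewrite !mulr1 !mulN1r !opprK !mul1r addr0 addrA.
congr (pd _ (u _) _ - pd _ (u _) _ + pd _ (u _) _);
  by apply: eq_from_tnth => -[[|[|]]//= ?]; rewrite tnth_mktuple.
Qed.

Lemma rext_d3 n (u : rform n 3) p q r s y :
  rext_d u [tuple p; q; r; s] y =
  pd p (u [tuple q; r; s]) y - pd q (u [tuple p; r; s]) y
  + pd r (u [tuple p; q; s]) y - pd s (u [tuple p; q; r]) y.
Proof.
rewrite /rext_d !big_ord_recl big_ord0 /= !expr0 !exprS !expr0.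
rewrite !mulr1 !mulN1r !opprK !mulN1r !mul1r addr0 !addrA.
congr (pd _ (u _) _ - pd _ (u _) _ + pd _ (u _) _ - pd _ (u _) _);
  by apply: eq_from_tnth => -[[|[|[|]]]//= ?]; rewrite tnth_mktuple.
Qed.

Lemma sum4C12 (V : nmodType) (F : 'I_4 -> 'I_4 -> 'I_4 -> 'I_4 -> V) :
  \sum_p \sum_q \sum_r \sum_s F p q r s = \sum_p \sum_q \sum_r \sum_s F q p r s.
Proof. exact: exchange_big. Qed.

Lemma sum3C12 (V : nmodType) (F : 'I_4 -> 'I_4 -> 'I_4 -> V) :
  \sum_p \sum_q \sum_r F p q r = \sum_p \sum_q \sum_r F q p r.
Proof. exact: exchange_big. Qed.

Lemma sum3C23 (V : nmodType) (F : 'I_4 -> 'I_4 -> 'I_4 -> V) :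
  \sum_p \sum_q \sum_r F p q r = \sum_p \sum_q \sum_r F p r q.
Proof. by apply: eq_bigr => p _; exact: exchange_big. Qed.

Lemma sum4C23 (V : nmodType) (F : 'I_4 -> 'I_4 -> 'I_4 -> 'I_4 -> V) :
  \sum_p \sum_q \sum_r \sum_s F p q r s = \sum_p \sum_q \sum_r \sum_s F p r q s.
Proof. by apply: eq_bigr => p _; exact: exchange_big. Qed.

Lemma sum4C34 (V : nmodType) (F : 'I_4 -> 'I_4 -> 'I_4 -> 'I_4 -> V) :
  \sum_p \sum_q \sum_r \sum_s F p q r s = \sum_p \sum_q \sum_r \sum_s F p q s r.
Proof. by do 2!apply: eq_bigr => ? _; exact: exchange_big. Qed.

Local Notation ep p q r s := ((eps4 p q r s)%:~R : R).

(** After relabelling, the four terms of the exterior derivative contribute equally: the sign of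
    each term is that of the permutation bringing its index to the front. *)
Lemma eps_ext_d3 (u : rform 4 3) y :
  \sum_(p < 4) \sum_(q < 4) \sum_(r < 4) \sum_(s < 4) ep p q r s * rext_d u [tuple p; q; r; s] y =
  4 * \sum_(p < 4) \sum_(q < 4) \sum_(r < 4) \sum_(s < 4) ep p q r s * pd p (u [tuple q; r; s]) y.
Proof.
pose S := \sum_(p < 4) \sum_(q < 4) \sum_(r < 4) \sum_(s < 4) ep p q r s * pd p (u [tuple q; r; s]) y.
have S2 : \sum_(p < 4) \sum_(q < 4) \sum_(r < 4) \sum_(s < 4) ep p q r s * pd q (u [tuple p; r; s]) y = - S.
  rewrite sum4C12 /S -sumrN; apply: eq_bigr => p _; rewrite -sumrN.
  apply: eq_bigr => q _; rewrite -sumrN; apply: eq_bigr => r _; rewrite -sumrN.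
  by apply: eq_bigr => s _; rewrite eps4C12 rmorphN mulNr.
have S3 : \sum_(p < 4) \sum_(q < 4) \sum_(r < 4) \sum_(s < 4) ep p q r s * pd r (u [tuple p; q; s]) y = S.
  rewrite sum4C23 sum4C12; do 4!apply: eq_bigr => ? _.
  by rewrite eps4C23 eps4C12 opprK.
have S4 : \sum_(p < 4) \sum_(q < 4) \sum_(r < 4) \sum_(s < 4) ep p q r s * pd s (u [tuple p; q; r]) y = - S.
  rewrite sum4C34 sum4C23 sum4C12 /S -sumrN; apply: eq_bigr => p _; rewrite -sumrN.
  apply: eq_bigr => q _; rewrite -sumrN; apply: eq_bigr => r _; rewrite -sumrN.
  by apply: eq_bigr => s _; rewrite eps4C34 eps4C23 eps4C12 opprK rmorphN mulNr.
rewrite -/S; transitivity (S - (- S) + S - (- S)); last by ring.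
rewrite -{1}S2 -{2}S3 -{1}S4 /S.
do 4!(rewrite -sumrB -big_split -sumrB /=; apply: eq_bigr => ? _).
by rewrite rext_d3; ring.
Qed.

Lemma eps_ext_d2 (u : rform 4 2) s y :
  \sum_(p < 4) \sum_(q < 4) \sum_(r < 4) ep p q r s * rext_d u [tuple p; q; r] y =
  3 * \sum_(p < 4) \sum_(q < 4) \sum_(r < 4) ep p q r s * pd p (u [tuple q; r]) y.
Proof.
pose S := \sum_(p < 4) \sum_(q < 4) \sum_(r < 4) ep p q r s * pd p (u [tuple q; r]) y.
have S2 : \sum_(p < 4) \sum_(q < 4) \sum_(r < 4) ep p q r s * pd q (u [tuple p; r]) y = - S.
  rewrite sum3C12 /S -sumrN; apply: eq_bigr => p _; rewrite -sumrN.
  apply: eq_bigr => q _; rewrite -sumrN; apply: eq_bigr => r _.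
  by rewrite eps4C12 rmorphN mulNr.
have S3 : \sum_(p < 4) \sum_(q < 4) \sum_(r < 4) ep p q r s * pd r (u [tuple p; q]) y = S.
  rewrite sum3C23 sum3C12; do 3!apply: eq_bigr => ? _.
  by rewrite eps4C23 eps4C12 opprK.
rewrite -/S; transitivity (S - (- S) + S); last by ring.
rewrite -{1}S2 -{2}S3 /S.
do 3!(rewrite -sumrB -big_split /=; apply: eq_bigr => ? _).
by rewrite rext_d2; ring.
Qed.

Lemma rstar1 (phi : 'rV[R]_4 -> R) (u : rform 4 1) q r s y : 0 < phi y ->
  rstar (fun y => (phi y)%:M) u [tuple q; r; s] y =
  phi y * \sum_(p < 4) ep p q r s * u [tuple p] y.
Proof.
move=> p0; rewrite rstar_conformal sum_tuple1.
rewrite (_ : phi y ^+ 4 = (phi y ^+ 2) ^+ 2); last by ring.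
rewrite sqrtr_sqr ger0_norm ?sqr_ge0//; congr (_ * _).
  by rewrite (_ : 1`! = 1)%N//; field; rewrite lt0r_neq0.
by apply: eq_bigr => p _; rewrite -levi_civita4.
Qed.

Lemma rstar2 (phi : 'rV[R]_4 -> R) (u : rform 4 2) r s y : 0 < phi y ->
  rstar (fun y => (phi y)%:M) u [tuple r; s] y =
  2^-1 * \sum_(p < 4) \sum_(q < 4) ep p q r s * u [tuple p; q] y.
Proof.
move=> p0; rewrite rstar_conformal sum_tuple2.
rewrite (_ : phi y ^+ 4 = (phi y ^+ 2) ^+ 2); last by ring.
rewrite sqrtr_sqr ger0_norm ?sqr_ge0//; congr (_ * _).
  by rewrite (_ : 2`! = 2)%N//; field; rewrite lt0r_neq0.
by do 2!apply: eq_bigr => ? _; rewrite -levi_civita4.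
Qed.

Lemma rstar3 (phi : 'rV[R]_4 -> R) (u : rform 4 3) s y : 0 < phi y ->
  rstar (fun y => (phi y)%:M) u [tuple s] y =
  6^-1 * (phi y)^-1 * \sum_(p < 4) \sum_(q < 4) \sum_(r < 4) ep p q r s * u [tuple p; q; r] y.
Proof.
move=> p0; rewrite rstar_conformal sum_tuple3.
rewrite (_ : phi y ^+ 4 = (phi y ^+ 2) ^+ 2); last by ring.
rewrite sqrtr_sqr ger0_norm ?sqr_ge0//; congr (_ * _).
  by rewrite (_ : 3`! = 6)%N//; field; rewrite lt0r_neq0.
by do 3!apply: eq_bigr => ? _; rewrite -levi_civita4.
Qed.

Lemma rstar4 (phi : 'rV[R]_4 -> R) (u : rform 4 4) y : 0 < phi y ->
  rstar (fun y => (phi y)%:M) u [tuple] y =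
  24^-1 * (phi y)^-2 * \sum_(p < 4) \sum_(q < 4) \sum_(r < 4) \sum_(s < 4)
    ep p q r s * u [tuple p; q; r; s] y.
Proof.
move=> p0; rewrite rstar_conformal sum_tuple4.
rewrite (_ : phi y ^+ 4 = (phi y ^+ 2) ^+ 2); last by ring.
rewrite sqrtr_sqr ger0_norm ?sqr_ge0//; congr (_ * _).
  by rewrite (_ : 4`! = 24)%N//; field; rewrite lt0r_neq0.
by do 4!apply: eq_bigr => ? _; rewrite -levi_civita4.
Qed.

Lemma sum_contract (I J : finType) (c : I -> R) (d : I -> J -> R) (G : J -> R) :
  \sum_i c i * \sum_a d i a * G a = \sum_a (\sum_i c i * d i a) * G a.
Proof.
under eq_bigr do rewrite mulr_sumr.
rewrite exchange_big/=; apply: eq_bigr => a _; rewrite mulr_suml.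
by apply: eq_bigr => i _; rewrite mulrA.
Qed.

Lemma eps_contract3 (p : 'I_4) (G : 'I_4 -> R) :
  \sum_(q < 4) \sum_(r < 4) \sum_(s < 4) ep p q r s * \sum_(a < 4) ep a q r s * G a = 6 * G p.
Proof.
rewrite pair_bigA pair_bigA/= sum_contract.
have E (a : 'I_4) : \sum_(x : 'I_4 * 'I_4 * 'I_4)
    ep p x.1.1 x.1.2 x.2 * ep a x.1.1 x.1.2 x.2 = 6 * (p == a)%:R.
  rewrite -(pair_bigA _ (fun (qr : 'I_4 * 'I_4) (s : 'I_4) =>
    ep p qr.1 qr.2 s * ep a qr.1 qr.2 s)).
  rewrite -(pair_bigA _ (fun q r : 'I_4 => \sum_(s < 4) ep p q r s * ep a q r s))/=.
  have /(congr1 (fun z : int => z%:~R : R)) := eps4_contract3 p a.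
  rewrite rmorphM/= !rmorph_nat => <-.
  rewrite rmorph_sum/=; apply: eq_bigr => q _; rewrite rmorph_sum/=.
  apply: eq_bigr => r _; rewrite rmorph_sum/=.
  by apply: eq_bigr => s _; rewrite rmorphM.
under eq_bigr do rewrite E.
rewrite (bigD1 p)//= eqxx mulr1 big1 ?addr0// => a ap.
by rewrite eq_sym (negbTE ap) mulr0 mul0r.
Qed.

Lemma eps_contract2 (p s : 'I_4) (G : 'I_4 -> 'I_4 -> R) :
  \sum_(q < 4) \sum_(r < 4) ep p q r s * \sum_(a < 4) \sum_(b < 4) ep a b q r * G a b =
  2 * (G p s - G s p).
Proof.
rewrite pair_bigA/=; under eq_bigr do rewrite pair_bigA/=.
rewrite (sum_contract _ _ (fun ab : 'I_4 * 'I_4 => G ab.1 ab.2)).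
have E (a b : 'I_4) : \sum_(qr : 'I_4 * 'I_4) ep p qr.1 qr.2 s * ep a b qr.1 qr.2 =
   2 * ((p == a)%:R * (s == b)%:R - (p == b)%:R * (s == a)%:R).
  rewrite -(pair_bigA _ (fun q r : 'I_4 => ep p q r s * ep a b q r))/=.
  have /(congr1 (fun z : int => z%:~R : R)) := eps4_contract2 p s a b.
  rewrite rmorphM rmorphB !rmorphM/= !rmorph_nat => <-.
  rewrite rmorph_sum/=; apply: eq_bigr => q _; rewrite rmorph_sum/=.
  by apply: eq_bigr => r _; rewrite rmorphM.
under eq_bigr do rewrite E.
rewrite -(pair_bigA _ (fun a b : 'I_4 =>
  2 * ((p == a)%:R * (s == b)%:R - (p == b)%:R * (s == a)%:R) * G a b))/=.
have D (H : 'I_4 -> R) c : \sum_(a < 4) (c == a)%:R * H a = H c.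
  rewrite (bigD1 c)//= eqxx mul1r big1 ?addr0// => a ac.
  by rewrite eq_sym (negbTE ac) mul0r.
transitivity (2 * (\sum_(a < 4) (p == a)%:R * (\sum_(b < 4) (s == b)%:R * G a b)
   - \sum_(a < 4) (s == a)%:R * (\sum_(b < 4) (p == b)%:R * G a b))).
  rewrite -sumrB mulr_sumr; apply: eq_bigr => a _.
  rewrite !mulr_sumr -sumrB mulr_sumr; apply: eq_bigr => b _; ring.
by rewrite !D.
Qed.

Section Codifferential.
Variables (phi : 'rV[R]_4 -> R) (u : rform 4 1).
Hypotheses (cphi : Coo phi) (phi_gt0 : forall y, 0 < phi y).
Hypothesis cu : forall p, Coo (u [tuple p]).

(** The inner star brings phi, the outer one phi^-2. The constants cancel as 24^-1 * 4 * 6: 1/4! of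
    the outer star, four equal terms of d, and 3! from the contraction. *)
Lemma rcodiff1 t y : rcodiff (fun y => (phi y)%:M) u t y =
  - ((phi y)^-2 * \sum_(p < 4) pd p (fun z => phi z * u [tuple p] z) y).
Proof.
rewrite /rcodiff (_ : (-1) ^+ _ = -1); last by rewrite -signr_odd.
rewrite mulN1r (tuple0 t) rstar4//; congr (- _).
rewrite eps_ext_d3 mulrA.
transitivity (24^-1 * (phi y)^-2 * 4 *
   \sum_(p < 4) 6 * pd p (fun z => phi z * u [tuple p] z) y).
  congr (_ * _); apply: eq_bigr => p _.
  rewrite -(eps_contract3 p (fun a => pd p (fun z => phi z * u [tuple a] z) y)).
  apply: eq_bigr => q _; apply: eq_bigr => r _; apply: eq_bigr => s _.
  congr (_ * _); set F := rstar _ _ _.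
  have -> : F = fun z => \sum_(a < 4) ep a q r s * (phi z * u [tuple a] z).
    apply/funext => z; rewrite /F rstar1// mulr_sumr.
    by apply: eq_bigr => a _; rewrite mulrCA.
  rewrite partial_sum; last by move=> a; apply: CooZ; exact: CooM.
  by apply: eq_bigr => a _; rewrite partialZ//; exact: CooM.
by rewrite -mulr_sumr; field; rewrite lt0r_neq0.
Qed.

(** The star of a 2-form does not see phi; phi^-1 comes from the outer star, on 3-forms. The
    constant is 6^-1 * 3 * 2: 1/3! of that star, three equal terms of d, and a 2 from the
    antisymmetry of [G], while the inner 1/2! cancels the 2 of the contraction. *)
Lemma rcodiff2_ext_d s y :
  rcodiff (fun y => (phi y)%:M) (rext_d u) [tuple s] y =
  - ((phi y)^-1 * (\sum_(p < 4) pd p (pd p (u [tuple s])) y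
                   - \sum_(p < 4) pd p (pd s (u [tuple p])) y)).
Proof.
rewrite /rcodiff (_ : (-1) ^+ _ = -1); last by rewrite -signr_odd.
rewrite mulN1r rstar3//; congr (- _).
rewrite eps_ext_d2 mulrA -sumrB.
pose G a b z := pd a (u [tuple b]) z - pd b (u [tuple a]) z.
have cG a b : Coo (G a b) by apply: CooB; exact: Coo_partial.
transitivity (6^-1 * (phi y)^-1 * 3 *
   \sum_(p < 4) 2^-1 * (2 * (pd p (G p s) y - pd p (G s p) y))).
  congr (_ * _); apply: eq_bigr => p _.
  rewrite -(eps_contract2 p s (fun a b => pd p (G a b) y)) mulr_sumr.
  apply: eq_bigr => q _; rewrite mulr_sumr; apply: eq_bigr => r _.
  rewrite mulrCA; congr (_ * _).
  set F := rstar _ _ _.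
  have -> : F = fun z => 2^-1 * \sum_(a < 4) \sum_(b < 4) ep a b q r * G a b z.
    apply/funext => z; rewrite /F rstar2//; congr (_ * _).
    by do 2!apply: eq_bigr => ? _; rewrite rext_d1.
  rewrite partialZ; last by do 2!apply: Coo_sum => ?; exact: CooZ.
  rewrite partial_sum; last by move=> a; apply: Coo_sum => ?; exact: CooZ.
  congr (_ * _); apply: eq_bigr => a _.
  rewrite partial_sum; last by move=> b; exact: CooZ.
  by apply: eq_bigr => b _; rewrite partialZ.
have E p : 2^-1 * (2 * (pd p (G p s) y - pd p (G s p) y)) =
    2 * (pd p (pd p (u [tuple s])) y - pd p (pd s (u [tuple p])) y).
  have dD a b z : derivable (pd a (u [tuple b])) z (delta_mx 0 p).
    by apply: Coo_derivable; exact: Coo_partial.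
  have EG a b : pd p (G a b) y =
      pd p (pd a (u [tuple b])) y - pd p (pd b (u [tuple a])) y.
    rewrite /G partialD// ?partialN//; first exact: Coo_partial.
    by move=> z; apply: derivableN.
  by rewrite !EG; field.
by under eq_bigr do rewrite E; rewrite -mulr_sumr; field; rewrite lt0r_neq0.
Qed.

End Codifferential.

End HodgeDim4.

(** * Periodic harmonic (1,0)-forms *)

Section Harmonic.
Context {R : realType}.
Local Notation rform := (@rform R).
Variables (phi : 'rV[R]_4 -> R) (k : 'I_4).
Hypotheses (cphi : Coo phi) (pphi : lattice_periodic phi).
Hypothesis phi_gt0 : forall y, 0 < phi y.
Hypothesis phi_k : forall b, b != k -> pd b phi = fun=> 0.

Let g (y : 'rV[R]_4) : 'M[R]_4 := (phi y)%:M.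

Section OneForm.
Variable u : rform 4 1.
Hypothesis cu : forall p, Coo (u [tuple p]).
Hypothesis pu : forall p, lattice_periodic (u [tuple p]).
Hypothesis u_harmonic : forall b y, rlaplacian g u [tuple b] y = 0.

Let h := rcodiff g u [tuple].

Let hE : h = fun y => - ((phi y)^-2 * \sum_p pd p (fun z => phi z * u [tuple p] z) y).
Proof. by apply/funext => y; rewrite /h rcodiff1. Qed.

Lemma Coo_codiff : Coo h.
Proof.
rewrite hE; apply: CooN; apply: CooM.
  apply: CooV; first by move=> y; rewrite expf_neq0// lt0r_neq0.
  exact: CooM.
by apply: Coo_sum => p; apply: Coo_partial; exact: CooM.
Qed.

Lemma codiff_periodic : lattice_periodic h.
Proof.
move=> y v lv; rewrite hE pphi//; congr (- (_ * _)); apply: eq_bigr => p _.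
by rewrite lattice_periodic_partial// => z w lw; rewrite pphi// pu.
Qed.

Lemma harmonic_eq b y : phi y * pd b h y =
  \sum_p pd p (pd p (u [tuple b])) y - \sum_p pd p (pd b (u [tuple p])) y.
Proof.
have := u_harmonic b y; rewrite /rlaplacian rext_d0 -/h rcodiff2_ext_d//.
move/eqP; rewrite subr_eq0 => /eqP ->.
by rewrite mulrA mulfV ?mul1r// lt0r_neq0.
Qed.

Lemma harmonic_codiff_constant b y : pd b h y = 0.
Proof.
apply: (liouville cphi Coo_codiff codiff_periodic phi_gt0 phi_k) => {b y} y.
have c3 a b c d : Coo (pd a (pd b (pd c (u [tuple d])))) by do 3!apply: Coo_partial.
have E b : pd b (fun x => phi x * pd b h x) y =
    \sum_p pd b (pd p (pd p (u [tuple b]))) y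
    - \sum_p pd b (pd p (pd b (u [tuple p]))) y.
  rewrite (_ : (fun x => phi x * pd b h x) = fun x =>
    \sum_p pd p (pd p (u [tuple b])) x + - \sum_p pd p (pd b (u [tuple p])) x).
    rewrite partialD; last 2 first.
    - by move=> z; apply: Coo_derivable; apply: Coo_sum => p; do 2!apply: Coo_partial.
    - move=> z; apply: Coo_derivable; apply: CooN.
      by apply: Coo_sum => p; do 2!apply: Coo_partial.
    rewrite partialN; last by apply: Coo_sum => p; do 2!apply: Coo_partial.
    by rewrite !partial_sum// => p; do 2!apply: Coo_partial.
  by apply/funext => x; exact: harmonic_eq.
under eq_bigr do rewrite E.
(* Exchanging b and p in the second double sum makes the two sums agree term by term, up to the
   order of the derivatives. *)
rewrite sumrB [X in _ - X]exchange_big -sumrB big1// => b _.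
rewrite -sumrB big1// => p _.
by rewrite (Coo_partialC b p (Coo_partial p (cu b))) subrr.
Qed.

Lemma harmonic_laplacian b y :
  \sum_p pd p (pd p (u [tuple b])) y = pd b (fun z => \sum_p pd p (u [tuple p]) z) y.
Proof.
have := harmonic_eq b y; rewrite harmonic_codiff_constant mulr0 => /esym/eqP.
rewrite subr_eq0 => /eqP ->; rewrite partial_sum; last by move=> p; exact: Coo_partial.
by apply: eq_bigr => p _; rewrite (Coo_partialC p b).
Qed.

(** For constant components, h = - phi^-2 (d_k phi) u_k. Being constant, h vanishes at y1 because it
    does at y0. *)
Lemma constant_harmonic_vanish y0 y1 : (forall p y, u [tuple p] y = u [tuple p] 0) ->
  pd k phi y0 = 0 -> pd k phi y1 != 0 -> u [tuple k] 0 = 0.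
Proof.
move=> uc phi0 phi1.
have H y : h y = - ((phi y)^-2 * (pd k phi y * u [tuple k] 0)).
  rewrite hE; congr (- (_ * _)).
  rewrite (bigD1 k)//= big1 ?addr0 => [|p pk].
    rewrite partialM; try by move=> z; exact: Coo_derivable.
    have -> : u [tuple k] = fun=> u [tuple k] 0 by apply/funext => z; exact: uc.
    by rewrite partial_cst mulr0 addr0.
  rewrite partialM; try by move=> z; exact: Coo_derivable.
  have -> : u [tuple p] = fun=> u [tuple p] 0 by apply/funext => z; exact: uc.
  by rewrite partial_cst mulr0 addr0 phi_k// mul0r.
have E : h y1 = h y0.
  by rewrite !(constant_of_partial Coo_codiff harmonic_codiff_constant _).
move: E; rewrite !H phi0 mul0r mulr0 oppr0 => /eqP.
rewrite oppr_eq0 !mulf_eq0 invr_eq0 expf_eq0 (negbTE (lt0r_neq0 (phi_gt0 y1))).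
by rewrite (negbTE phi1) => /eqP.
Qed.

End OneForm.

Lemma flat_liouville (w : 'rV[R]_4 -> R) : Coo w -> lattice_periodic w ->
  (forall y, \sum_p pd p (pd p w) y = 0) -> forall b y, pd b w y = 0.
Proof.
move=> cw pw Hw; apply: (@liouville _ _ (fun=> 1) w k) => //.
- exact: Coo_cst.
- by move=> b _; rewrite partial_cst.
move=> y; rewrite -[RHS](Hw y); apply: eq_bigr => p _.
by congr (pd p _ y); apply/funext => x; rewrite mul1r.
Qed.

(* u + 'i v is of type (1,0). *)
Variables u v : rform 4 1.
Hypothesis cu : forall p, Coo (u [tuple p]).
Hypothesis pu : forall p, lattice_periodic (u [tuple p]).
Hypothesis u_harmonic : forall b y, rlaplacian g u [tuple b] y = 0.
Hypothesis cv : forall p, Coo (v [tuple p]).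
Hypothesis pv : forall p, lattice_periodic (v [tuple p]).
Hypothesis v_harmonic : forall b y, rlaplacian g v [tuple b] y = 0.
(** [l c] and [r c] index the real coordinates x_c and y_c; [ur] and [vr] are the two parts of
    w_(y_c) = 'i w_(x_c). *)
Let l (c : 'I_2) : 'I_4 := lshift 2 c.
Let r (c : 'I_2) : 'I_4 := rshift 2 c.
Hypothesis ur : forall c y, u [tuple r c] y = - v [tuple l c] y.
Hypothesis vr : forall c y, v [tuple r c] y = u [tuple l c] y.

Let D (w : rform 4 1) y := \sum_p pd p (w [tuple p]) y.

Let CooDiv w : (forall p, Coo (w [tuple p])) -> Coo (D w).
Proof. by move=> cw; apply: Coo_sum => p; exact: Coo_partial. Qed.

Let periodicDiv w : (forall p, lattice_periodic (w [tuple p])) ->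
  lattice_periodic (D w).
Proof.
by move=> pw y z lz; apply: eq_bigr => p _; exact: lattice_periodic_partial.
Qed.

(** With [Dvr], the Cauchy-Riemann equations of D u + 'i D v: each derivative d_b is replaced by the
    flat Laplacian of the b-th component, to which [ur] and [vr] apply. *)
Let Dur c : pd (r c) (D u) = fun y => - pd (l c) (D v) y.
Proof.
apply/funext => y; rewrite -!harmonic_laplacian// -sumrN; apply: eq_bigr => p _.
have -> : u [tuple r c] = fun y => - v [tuple l c] y by apply/funext => z.
by rewrite partialN// partialN//; exact: Coo_partial.
Qed.

Let Dvr c : pd (r c) (D v) = pd (l c) (D u).
Proof.
apply/funext => y; rewrite -!harmonic_laplacian//; apply: eq_bigr => p _.
by have -> : v [tuple r c] = u [tuple l c] by apply/funext => z.
Qed.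

(** In each plane (x_c, y_c) the two second derivatives cancel by the Cauchy-Riemann equations. *)
Let Du_harmonic y : \sum_p pd p (pd p (D u)) y = 0.
Proof.
rewrite (@big_split_ord _ _ _ 2 2)/= -big_split big1// => c _.
rewrite -/(l c) -/(r c) Dur partialN; last by apply: Coo_partial; exact: CooDiv.
by rewrite (Coo_partialC _ _ (CooDiv cv)) Dvr /= subrr.
Qed.

Let Dv_harmonic y : \sum_p pd p (pd p (D v)) y = 0.
Proof.
rewrite (@big_split_ord _ _ _ 2 2)/= -big_split big1// => c _.
rewrite -/(l c) -/(r c) Dvr (Coo_partialC _ _ (CooDiv cu)) Dur partialN.
  by rewrite /= subrr.
by apply: Coo_partial; exact: CooDiv.
Qed.

Lemma harmonic10_constant p y :
  u [tuple p] y = u [tuple p] 0 /\ v [tuple p] y = v [tuple p] 0.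
Proof.
have H (w : rform 4 1) : (forall p, Coo (w [tuple p])) ->
    (forall p, lattice_periodic (w [tuple p])) ->
    (forall b y, rlaplacian g w [tuple b] y = 0) ->
    (forall y, \sum_p pd p (pd p (D w)) y = 0) -> w [tuple p] y = w [tuple p] 0.
  move=> cw pw hw Dw; apply: constant_of_partial => //.
  apply: flat_liouville => // z; rewrite harmonic_laplacian//.
  by apply: flat_liouville => //; [exact: CooDiv|exact: periodicDiv].
by split; exact: H.
Qed.

Lemma harmonic10_vanish y0 y1 : pd k phi y0 = 0 -> pd k phi y1 != 0 ->
  u [tuple k] 0 = 0 /\ v [tuple k] 0 = 0.
Proof.
move=> phi0 phi1; split; apply: (constant_harmonic_vanish _ _ _ _ phi0 phi1) => //.
  by move=> p y; have [] := harmonic10_constant p y.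
by move=> p y; have [] := harmonic10_constant p y.
Qed.

End Harmonic.

(** * The torus R^n / Z^n *)

Section Torus.
Local Open Scope quotient_scope.
Context (R : realType) (n : nat).
Implicit Types x y c v : 'rV[R]_n.

Definition lattice_rel x y := [forall i, (y 0 i - x 0 i) \is a Num.int].

Lemma lattice_relP x y : reflect (lattice_vector (y - x)) (lattice_rel x y).
Proof. by apply: (iffP forallP) => H i; have := H i; rewrite !mxE. Qed.

Lemma lattice_vectorN v : lattice_vector v -> lattice_vector (- v).
Proof. by move=> lv i; rewrite mxE rpredN. Qed.

Lemma lattice_vectorD v w : lattice_vector v -> lattice_vector w ->
  lattice_vector (v + w).
Proof. by move=> lv lw i; rewrite mxE rpredD. Qed.

Lemma lattice_vector0 : lattice_vector (0 : 'rV[R]_n).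
Proof. by move=> i; rewrite mxE rpred0. Qed.

Lemma lattice_rel_refl : reflexive lattice_rel.
Proof. by move=> x; apply/lattice_relP; rewrite subrr; exact: lattice_vector0. Qed.

Lemma lattice_rel_sym : symmetric lattice_rel.
Proof.
by move=> x y; apply/lattice_relP/lattice_relP => /lattice_vectorN; rewrite opprB.
Qed.

Lemma lattice_rel_trans : transitive lattice_rel.
Proof.
move=> y x z /lattice_relP xy /lattice_relP yz; apply/lattice_relP.
by rewrite -(subrKA y); exact: lattice_vectorD.
Qed.

Definition lattice_equiv :=
  EquivRel lattice_rel lattice_rel_refl lattice_rel_sym lattice_rel_trans.

Definition torus := quotient_topology {eq_quot lattice_equiv}.

HB.instance Definition _ := Topological.on torus.
HB.instance Definition _ := Quotient.on torus.

Definition torus_pi : 'rV[R]_n -> torus := \pi_torus%qT.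

Lemma torus_piP x y : torus_pi x = torus_pi y <-> lattice_vector (y - x).
Proof.
split=> [H|H].
  by apply/lattice_relP; move/eqquotP: H.
by apply/eqquotP/lattice_relP.
Qed.

Lemma torus_piD x v : lattice_vector v -> torus_pi (x + v) = torus_pi x.
Proof. by move=> lv; apply/esym/torus_piP; rewrite addrAC subrr add0r. Qed.

Lemma torus_piE x y : torus_pi x = torus_pi y ->
  exists2 v, lattice_vector v & y = x + v.
Proof. by move/torus_piP => lv; exists (y - x); rewrite // addrC subrK. Qed.

Lemma torus_pi_surj (p : torus) : exists x, torus_pi x = p.
Proof. by exists (repr p); rewrite /torus_pi reprK. Qed.

Lemma torus_pi_continuous : continuous torus_pi.
Proof. exact: pi_continuous. Qed.

Lemma torus_openP (U : set torus) : open U <-> open (torus_pi @^-1` U).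
Proof. by []. Qed.

Lemma open_translate (U : set 'rV[R]_n) v : open U -> open [set x | U (x + v)].
Proof.
move=> oU; apply: (@open_comp _ _ (fun x => x + v) U) => // x _.
exact: (cvgD cvg_id (cvg_cst _)).
Qed.

(** The saturation of U is the union of its lattice translates. *)
Lemma torus_pi_open (U : set 'rV[R]_n) : open U -> open (torus_pi @` U).
Proof.
move=> oU; apply/torus_openP.
have -> : torus_pi @^-1` (torus_pi @` U) =
    \bigcup_(v in [set v | lattice_vector v]) [set x | U (x + v)].
  apply/seteqP; split=> [x [y Uy /esym/torus_piE[v lv E]]|x [v /= lv Uxv]].
    by exists v => //=; rewrite -E.
  by exists (x + v) => //; exact: torus_piD.
by apply: bigcup_open => v _; exact: open_translate.
Qed.

Lemma torus_compact : compact [set: torus].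
Proof.
pose K := [set v : 'rV[R]_n | forall i, `[0, 1]%classic (v ord0 i)].
have cK : compact K.
  exact: (@rV_compact R n (fun=> `[0, 1]%classic) (fun=> @segment_compact R 0 1)).
have -> : [set: torus] = torus_pi @` K.
  apply/seteqP; split=> // p _; have [x <-] := torus_pi_surj p.
  have [v lv Kv] := lattice_fundamental_domain x.
  exists (x + v); last exact: torus_piD.
  by move=> i /=; rewrite in_itv; exact: Kv.
apply: continuous_compact => //; apply: continuous_subspaceT.
exact: torus_pi_continuous.
Qed.

Lemma ball_coord x y (e : R) : ball x e y -> forall i, `|x 0 i - y 0 i| < e.
Proof. by move=> [_ H] i; exact: H. Qed.

Lemma coord_ball x y (e : R) : 0 < e -> (forall i, `|x 0 i - y 0 i| < e) ->
  ball x e y.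
Proof. by move=> e0 H; split=> // i j; rewrite (ord1 i); exact: H. Qed.

Lemma torus_hausdorff : hausdorff_space torus.
Proof.
rewrite open_hausdorff => p q; have [x <-] := torus_pi_surj p.
have [y <-] := torus_pi_surj q => /eqP xy.
have [i xyi] : exists i, (y 0 i - x 0 i) \isn't a Num.int.
  apply/existsP; rewrite -negb_forall; apply/negP => /forallP H; apply: xy.
  by apply/torus_piP => i; have := H i; rewrite !mxE.
set t := y 0 i - x 0 i in xyi.
pose m : R := (Num.floor t)%:~R.
have mt : m < t.
  rewrite lt_neqAle floor_le andbT; apply: contra xyi => /eqP <-; exact: intr_int.
have tm : t < m + 1 by rewrite -[X in _ + X]/(1%:~R) -intrD floorD1_gt.
(* Half the distance from t to the integers: for a and b in the two balls, b - a differs from t by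
   less than 2 d in the i-th coordinate, so it is no integer there. *)
pose d := Num.min (t - m) (m + 1 - t) / 2.
have d0 : 0 < d by rewrite divr_gt0// lt_min !subr_gt0 mt.
exists (torus_pi @` ball x d, torus_pi @` ball y d) => /=.
  by split; rewrite inE; [exists x|exists y] => //; exact: ballxx.
split; try by apply: torus_pi_open; exact: ball_open.
apply/eqP/seteqP; split=> // _ [[a xa <-] [b yb /esym/torus_piP lv]].
have /intrP[k Ek] := lv i.
have {}xa := ball_coord xa i; have {}yb := ball_coord yb i.
move: xa yb; rewrite !ltr_distl => /andP[xa1 xa2] /andP[yb1 yb2].
rewrite !mxE in Ek.
have dm : d + d <= t - m by rewrite /d -splitr ge_min lexx.
have dm' : d + d <= m + 1 - t by rewrite /d -splitr ge_min lexx orbT.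
exfalso; have [km|km] := leP k (Num.floor t).
  have : (k%:~R : R) <= m by rewrite ler_int.
  by move: dm; rewrite -Ek /t; lra.
have : m + 1 <= (k%:~R : R) by rewrite -[X in _ + X]/(1%:~R) -intrD ler_int lezD1.
by move: dm'; rewrite -Ek /t; lra.
Qed.

Lemma torus_second_countable : @second_countable torus.
Proof.
pose f (a : 'rV[rat]_n * nat) : set torus :=
  torus_pi @` ball (map_mx ratr a.1 : 'rV[R]_n) (a.2.+1%:R^-1).
exists (range f).
  apply: sub_countable (card_image_le f setT) _; exact: countableP.
split=> [_ [a _ <-]|p W].
  by apply: torus_pi_open; exact: ball_open.
have [x <-] := torus_pi_surj p => Wx.
have /nbhs_ballP[e /= e0 He] := torus_pi_continuous Wx.
(* Twice the radius, since x is not the centre: the rational ball through x must fit into the ball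
   of radius e at x. *)
have [k Hk] : exists k, 2 * (k.+1%:R^-1 : R) < e.
  exists (Num.truncn (2 / e)); rewrite mulrC -ltr_pdivlMr// invf_plt ?posrE ?divr_gt0//.
  by rewrite invf_div truncnS_gt.
set r : R := k.+1%:R^-1 in Hk; have r0 : 0 < r by rewrite invr_gt0.
have H i : exists q : rat, `|ratr q - x 0 i| < r.
  have [|z [/= xz [q _ qz]]] := @dense_rat R (ball (x 0 i) r) _ (ball_open _ _).
    by exists (x 0 i); exact: ballxx.
  by exists q; rewrite distrC qz.
have /choice[q Hq] := H; pose Q := \row_i q i.
have bx : ball (map_mx ratr Q : 'rV[R]_n) r x.
  by apply: coord_ball => // i; rewrite !mxE.
exists (f (Q, k)).
  by split; [exists (Q, k)|exists x].
move=> _ [y by_ <-]; apply: He; apply: coord_ball => // i.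
have := ball_coord by_ i; have := ball_coord bx i.
set z := _ 0 i => H1 H2; rewrite -(subrKA z).
rewrite (le_lt_trans (ler_normD _ _))// (lt_trans _ Hk)//.
by rewrite -/r mulr_natl mulr2n ltrD// distrC.
Qed.

(** There is a chart around every point c of R^n. Coordinates within a ball of radius 1/2 differ by
    less than 1, so the projection is injective on it. *)
Definition torus_dom c : set torus := torus_pi @` ball c (2^-1 : R).

(** Off the domain no representative qualifies, and the default value c is returned. *)
Definition torus_coord c (p : torus) : 'rV[R]_n :=
  xget c [set x | ball c 2^-1 x /\ torus_pi x = p].

Lemma half_gt0 : 0 < 2^-1 :> R. Proof. by rewrite invr_gt0. Qed.
Hint Resolve half_gt0 : core.

Lemma torus_coordP c p : torus_dom c p ->
  ball c 2^-1 (torus_coord c p) /\ torus_pi (torus_coord c p) = p.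
Proof.
move=> [x bx <-]; rewrite /torus_coord.
by case: xgetP => [y -> //|/(_ x)[]].
Qed.

(* An integer of absolute value less than 1 vanishes. *)
Lemma torus_coord_pi c x : ball c 2^-1 x -> torus_coord c (torus_pi x) = x.
Proof.
move=> bx; have dx : torus_dom c (torus_pi x) by exists x.
have [by_ /esym/torus_piP lv] := torus_coordP dx.
apply/rowP => i; apply/eqP; rewrite -subr_eq0.
have /intrP[k Ek] := lv i.
have {by_} := ball_coord by_ i; have {bx} := ball_coord bx i.
rewrite !ltr_distl => /andP[h1 h2] /andP[h3 h4].
move: Ek; rewrite !mxE => Ek.
have /andP[k1 k2] : (-1 < k < 1)%R.
  by rewrite -!(ltr_int R) -Ek rmorphN /=; lra.
have -> : torus_coord c (torus_pi x) 0 i - x 0 i = k%:~R by [].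
by rewrite intr_eq0; lia.
Qed.

Lemma torus_dom_open c : open (torus_dom c).
Proof. by apply: torus_pi_open; exact: ball_open. Qed.

Lemma torus_dom_cover p : exists c, torus_dom c p.
Proof.
have [x <-] := torus_pi_surj p; exists x; exists x => //; exact: ballxx.
Qed.

Lemma torus_chart_image c : torus_coord c @` torus_dom c = ball c 2^-1.
Proof.
apply/seteqP; split=> [_ [p /torus_coordP[bp _] <-]//|x bx].
by exists (torus_pi x); [exists x|exact: torus_coord_pi].
Qed.

Lemma torus_coord_open c : open (torus_coord c @` torus_dom c).
Proof. by rewrite torus_chart_image; exact: ball_open. Qed.

Lemma torus_coordK c p : torus_dom c p -> torus_pi (torus_coord c p) = p.
Proof. by move=> /torus_coordP[]. Qed.

Lemma torus_coord_continuous c p : torus_dom c p ->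
  {for p, continuous (torus_coord c)}.
Proof.
move=> dp W; rewrite nbhsE => -[V [oV Vp] VW]; rewrite nbhsE.
exists (torus_pi @` (V `&` ball c 2^-1)).
  split; first by apply/torus_pi_open/openI => //; exact: ball_open.
  by have [bp E] := torus_coordP dp; exists (torus_coord c p).
by move=> _ [x [Vx bx] <-]; apply: VW; rewrite torus_coord_pi.
Qed.

Definition torus_atlas : atlas R n torus :=
  @Atlas R n torus 'rV[R]_n torus_dom torus_coord (fun=> torus_pi)
    torus_dom_open torus_dom_cover torus_coord_open torus_coordK
    torus_coord_continuous (fun _ y _ => torus_pi_continuous (x := y)).

(** The lattice vector that brings x into the open ball also brings the points near x into it. All
    transition maps are therefore local translations, with identity Jacobian. *)
Lemma torus_coord_near c x : torus_dom c (torus_pi x) ->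
  exists2 v, lattice_vector v &
    ball c 2^-1 (x + v) /\ \near x, torus_coord c (torus_pi x) = x + v.
Proof.
move=> [y by_ /esym/torus_piE[v lv E]]; exists v => //; rewrite -E; split=> //.
have : nbhs x [set z | ball c 2^-1 (z + v)].
  apply: open_nbhs_nbhs; split; last by rewrite /= -E.
  by apply: open_translate; exact: ball_open.
apply: filterS => z bz.
by rewrite -(torus_piD z lv) torus_coord_pi.
Qed.

End Torus.

(** * Differentials of maps that are locally translations *)

Section NearDifferential.
Context {K : numFieldType} {V W : normedModType K}.

(** Stated over any ground field, to serve both the real Jacobians and the holomorphy of the complex
    atlas. *)
Lemma near_eq_diff (f g : V -> W) x : (\near x, f x = g x) ->
  differentiable g x -> differentiable f x /\ 'd f x = 'd g x :> (V -> W).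
Proof.
move=> fg dg; have dgc := diff_continuous dg.
have E : f \o shift x = cst (f x) + 'd g x +o_ 0 id.
  have /eqaddoP H := diff_locally dg.
  apply/eqaddoP => e e0; have := H e e0.
  move: (fg); rewrite (near_shift 0) subr0 (nbhs_singleton fg); apply: filterS2 => h /= fgh.
  by rewrite ![in X in X -> _]/GRing.add /= ![in X in _ -> X]/GRing.add/= fgh.
have Ed := diff_unique dgc E; split=> //.
by apply/diff_locallyP; rewrite Ed.
Qed.

End NearDifferential.

Section Translation.
Context {K : numFieldType} {n : nat}.

Lemma near_translation_differentiable (f : 'rV[K]_n -> 'rV[K]_n) x v :
  (\near x, f x = x + v) -> differentiable f x.
Proof. by move=> fv; apply: (near_eq_diff fv _).1. Qed.

Lemma near_translation_jacobian (f : 'rV[K]_n -> 'rV[K]_n) x v :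
  (\near x, f x = x + v) -> 'J f x = 1%:M.
Proof.
move=> fv; have dv : is_diff x (fun z : 'rV[K]_n => z + v) (id + 0) by exact: is_diffD.
case: dv => dd Ed.
apply/row_matrixP => i; rewrite row1 rowE /jacobian mul_rV_lin1.
by rewrite (near_eq_diff fv dd).2 Ed /GRing.add/= addr0.
Qed.

End Translation.

(** * Smooth and Hermitian structures on the torus *)

Section Coordinates.
Context {R : realType} {n : nat}.
Implicit Types (f : 'rV[R]_n -> R) (x y v : 'rV[R]_n).

Lemma partial_coord (a i : 'I_n) :
  pd a (fun y : 'rV[R]_n => y 0 i) = fun=> (a == i)%:R.
Proof.
apply/funext => y; rewrite pdE /partial.
have /(congr1 (fun M : 'rV[R]_n => M 0 i)) :=
  derive_mx (@derivable_id _ _ y (delta_mx 0 a : 'rV[R]_n)).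
by rewrite derive_id !mxE eqxx /= eq_sym => <-.
Qed.

Lemma Coo_coord (i : 'I_n) : Coo (fun y : 'rV[R]_n => y 0 i).
Proof.
have C0 : forall y, {for y, continuous (fun y : 'rV[R]_n => y 0 i)} /\
    forall a, derivable (fun y : 'rV[R]_n => y 0 i) y (delta_mx 0 a).
  move=> y; split=> [|a]; first exact: matrix_normedtype.coord_continuous.
  exact: (derivable_mxP _ _ _).1 (@derivable_id _ _ y _) 0 i.
case=> [|k]; split=> // a; rewrite partial_coord; exact: Coo_cst.
Qed.

Lemma smooth_sub (U V : set 'rV[R]_n) f : U `<=` V -> smooth V f -> smooth U f.
Proof. by move=> UV sf s h y /UV; exact: sf. Qed.

Lemma smooth_Coo (U : set 'rV[R]_n) f : Coo f -> smooth U f.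
Proof. by move=> /CooP; apply: smooth_sub. Qed.

Lemma near_translation_smooth (U : set 'rV[R]_n) (f : 'rV[R]_n -> 'rV[R]_n) :
  (forall y, U y -> exists v, \near y, f y = y + v) -> smooth_map U f.
Proof.
move=> H i; apply: (smooth_near (V := setT)) => y /H[v fv].
exists (fun y => y 0 i + v 0 i); last first.
  by split=> //; apply: filterS fv => z ->; rewrite mxE.
by apply/CooP; apply: CooD; [exact: Coo_coord|exact: Coo_cst].
Qed.

End Coordinates.

Section TorusManifold.
Context (R : realType) (n : nat).
Local Notation A := (torus_atlas R n).
Implicit Types (x y v : 'rV[R]_n) (c d : chart_index A).

Lemma torus_chart_imageE c : chart_image c = ball (c : 'rV[R]_n) 2^-1.
Proof. exact: torus_chart_image. Qed.

Lemma torus_overlapP c d y :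
  overlap c d y <-> ball (c : 'rV[R]_n) 2^-1 y /\ torus_dom d (torus_pi y).
Proof.
split=> [[p [/torus_coordP[bc Ep] dp]] <-|[bc dy]]; first by rewrite Ep.
exists (torus_pi y); last exact: torus_coord_pi.
by split=> //; exists y.
Qed.

Lemma torus_transition_near c d y : overlap c d y ->
  exists2 v, lattice_vector v & \near y, transition c d y = y + v.
Proof. by move=> /torus_overlapP[_ /torus_coord_near[v lv [_ H]]]; exists v. Qed.

Lemma torus_transition_jacobian c d y : overlap c d y ->
  'J (transition c d) y = 1%:M.
Proof. by move=> /torus_transition_near[v _ /near_translation_jacobian]. Qed.

Lemma torus_transition_lattice c d y : overlap c d y ->
  exists2 v, lattice_vector v & transition c d y = y + v.
Proof.
by move=> /torus_transition_near[v lv H]; exists v => //; exact: nbhs_singleton H.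
Qed.

Lemma torus_smooth_manifold : smooth_manifold A.
Proof.
split; [exact: torus_hausdorff|exact: torus_second_countable|move=> c d].
by apply: near_translation_smooth => y /torus_transition_near[v _ H]; exists v.
Qed.

Lemma torus_almost_complex (J0 : 'M[R]_n) : J0 *m J0 = - 1%:M ->
  almost_complex (A := A) (fun _ _ => J0).
Proof.
move=> J2; split=> //; first by move=> *; apply/smooth_Coo/Coo_cst.
by move=> c d y /torus_transition_jacobian ->; rewrite mulmx1 mul1mx.
Qed.

(** Transitions translate by lattice vectors, so periodicity of phi is what makes the local metrics
    agree; an orthogonal J0 stays isometric under scaling. *)
Lemma torus_almost_hermitian (J0 : 'M[R]_n) (phi : 'rV[R]_n -> R) :
  J0 *m J0^T = 1%:M -> Coo phi -> lattice_periodic phi -> (forall y, 0 < phi y) ->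
  almost_hermitian (A := A) (fun _ _ => J0) (fun _ y => (phi y)%:M).
Proof.
move=> JJ cphi pphi phi_gt0; split; last first.
  by move=> c y _; rewrite mul_mx_scalar -scalemxAl JJ scalemx1.
split.
- move=> c a b; apply: smooth_Coo; apply: (@Coo_ext _ _ (fun y => (a == b)%:R * phi y)).
    by move=> y; rewrite mxE mulr_natl.
  by apply: CooM => //; exact: Coo_cst.
- move=> c d y ov; rewrite torus_transition_jacobian// trmx1 mulmx1 mul1mx.
  by have [v lv ->] := torus_transition_lattice ov; rewrite pphi.
- by move=> c y _; rewrite tr_scalar_mx.
move=> c y _ v v0; rewrite mul_mx_scalar -scalemxAl mxE mulr_gt0//.
rewrite mxE lt_neqAle eq_sym; apply/andP; split; last first.
  by apply: sumr_ge0 => i _; rewrite mxE -expr2 sqr_ge0.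
apply: contra v0; rewrite psumr_eq0; last by move=> i _; rewrite mxE -expr2 sqr_ge0.
move=> /allP H; apply/eqP/rowP => i; have := H i (mem_index_enum _).
by rewrite !mxE mulf_eq0 orbb => /eqP.
Qed.

End TorusManifold.

(** * The complex structure of the torus *)

(* The topology of a [numFieldType] is inferred from its carrier being in the
   form [Num.NumField.sort _], which is not the case of [R[i]]. *)
Definition cnum (R : realType) : numFieldType := R[i]%C.

Section ComplexTorus.
Context (R : realType) (m : nat).
Local Open Scope complex_scope.
Local Notation realify := (@realify R m : 'rV[cnum R]_m -> 'rV[R]_(m + m)).
Local Notation complexify := (@complexify R m : 'rV[R]_(m + m) -> 'rV[cnum R]_m).
Local Notation A := (torus_atlas R (m + m)).

Lemma realifyK (z : 'rV[cnum R]_m) : complexify (realify z) = z.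
Proof.
apply/rowP => c; rewrite !mxE (unsplitK (inl c)) (unsplitK (inr c)) !mxE.
by case: (z 0 c).
Qed.

Lemma complexifyK x : realify (complexify x) = x.
Proof.
apply/rowP => a; rewrite !mxE; case: splitP => c Ec; rewrite !mxE /=;
  by congr (x 0 _); apply: val_inj.
Qed.

Lemma complexifyD x v : complexify (x + v) = complexify x + complexify v.
Proof. by apply/rowP => c; rewrite !mxE. Qed.

(** Radii of balls over [R[i]] are positive complex numbers, hence real ones. *)
Lemma posc_real (e : R[i]) : 0 < e -> e = (complex.Re e)%:C /\ 0 < complex.Re e.
Proof. by case: e => a b; rewrite ltcE/= => /andP[/eqP -> a0]; split. Qed.

Lemma normc_le (a b : R) : `|a +i* b| <= (`|a| + `|b|)%:C.
Proof.
rewrite normc_def lecR/= -[leRHS]ger0_norm ?addr_ge0// -sqrtr_sqr.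
by rewrite ler_wsqrtr// sqrrD !real_normK ?num_real// -addrA lerD2l lerDr mulrn_wge0 ?mulr_ge0.
Qed.

Lemma normc_ge_Im (z : R[i]) : `|complex.Im z|%:C <= `|z|.
Proof. by case: z => a b; rewrite normc_def lecR/= -sqrtr_sqr ler_wsqrtr// lerDr sqr_ge0. Qed.

Lemma complexify_continuous : continuous complexify.
Proof.
move=> x W /nbhs_ballP[e /= /posc_real[-> e0] He].
apply/nbhs_ballP; exists (complex.Re e / 2); first by rewrite /= divr_gt0.
move=> y xy; apply: He; split; first by rewrite ltcR.
move=> i j; rewrite !mxE /ball/= /ball_/=.
rewrite (_ : _ - _ = (x 0 (lshift m j) - y 0 (lshift m j)) +i*
   (x 0 (rshift m j) - y 0 (rshift m j)))//.
rewrite (le_lt_trans (normc_le _ _))// ltcR [ltRHS]splitr.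
by rewrite ltrD//; exact: ball_coord.
Qed.

Lemma realify_continuous : continuous realify.
Proof.
move=> z W /nbhs_ballP[e /= e0 He].
apply/(@nbhs_ballP (cnum R) _ z); exists (e%:C : cnum R); first by rewrite /= ltcR.
move=> y [_ zy]; apply: He; apply: coord_ball => // a.
rewrite !mxE; case: splitP => c _; rewrite !mxE.
  have := zy 0 c; rewrite /ball/= /ball_/= -ltcR; apply: le_lt_trans.
  by rewrite -raddfB; exact: normc_ge_Re.
have := zy 0 c; rewrite /ball/= /ball_/= -ltcR; apply: le_lt_trans.
by rewrite -raddfB; exact: normc_ge_Im.
Qed.

Let ccoord (c : 'rV[R]_(m + m)) p := complexify (torus_coord c p).
Let cparam (c : 'rV[R]_(m + m)) z := torus_pi (realify z).

Lemma ccoord_open c : open (ccoord c @` torus_dom c).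
Proof.
rewrite (_ : _ @` _ = realify @^-1` ball c 2^-1).
  apply: open_comp; first by move=> z _; exact: realify_continuous.
  exact: ball_open.
rewrite -torus_chart_image; apply/seteqP; split=> [_ [p dp <-]|z [p dp E]] /=.
  by exists p; rewrite // complexifyK.
by exists p; rewrite // /ccoord E realifyK.
Qed.

Lemma ccoordK c p : torus_dom c p -> cparam c (ccoord c p) = p.
Proof. by move=> dp; rewrite /cparam complexifyK torus_coordK. Qed.

Lemma ccoord_continuous c p : torus_dom c p -> {for p, continuous (ccoord c)}.
Proof.
move=> dp; apply: continuous_comp; first exact: torus_coord_continuous.
exact: complexify_continuous.
Qed.

Lemma cparam_continuous c z : (ccoord c @` torus_dom c) z ->
  {for z, continuous (cparam c)}.
Proof.
move=> _; apply: continuous_comp; first exact: realify_continuous.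
exact: torus_pi_continuous.
Qed.

(** The charts of [torus_atlas] read through [complexify], so that its transitions, and those to and
    from the real atlas, are again local translations. *)
Definition complex_torus_atlas : atlas (cnum R) m (torus R (m + m)) :=
  @Atlas _ _ _ _ _ _ _ (@torus_dom_open R _) (@torus_dom_cover R _) ccoord_open
    ccoordK ccoord_continuous cparam_continuous.

Local Notation B := complex_torus_atlas.

Lemma complex_torus_holomorphic : holomorphic_atlas B.
Proof.
move=> c d z [p [dc dd] Ez].
have [v _ [_ H]] : exists2 v, lattice_vector v &
    ball d 2^-1 (realify z + v) /\
    \forall x \near realify z, torus_coord d (torus_pi x) = x + v.
  apply: torus_coord_near; rewrite -Ez.
  by have := ccoordK dc; rewrite /cparam /ccoord /= => ->.
apply: (@near_translation_differentiable _ _ _ _ (complexify v)).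
have H' : \forall w \near z,
    torus_coord d (torus_pi (realify w)) = realify w + v.
  exact: realify_continuous H.
apply: filterS H' => w /= E.
by rewrite /transition /= /ccoord /cparam E complexifyD realifyK.
Qed.

Lemma complex_torus_smooth : same_smooth_structure A B.
Proof.
move=> c d; split; apply: near_translation_smooth => x.
  move=> [p [dc dd] <-].
  have dx : torus_dom d (torus_pi (torus_coord c p)) by rewrite torus_coordK.
  have [v _ [_ H]] := torus_coord_near dx.
  exists v; apply: filterS H => w /= E.
  by rewrite /transition /= /ccoord complexifyK E.
move=> /= [p [dc dd] E0].
have [v _ [_ H]] : exists2 v, lattice_vector v &
    ball (c : 'rV[R]_(m + m)) 2^-1 (x + v) /\
    \near x, torus_coord c (torus_pi x) = x + v.
  apply: torus_coord_near; move/(congr1 realify): E0; rewrite complexifyK /=.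
  by rewrite /ccoord complexifyK => <-; rewrite torus_coordK.
exists v; apply: filterS H => w /= E.
by rewrite /transition /= /cparam complexifyK E.
Qed.

(* In the coordinates (x_1, ..., x_m, y_1, ..., y_m). *)
Definition standard_J : 'M[R]_(m + m) := block_mx 0 1%:M (- 1%:M) 0.

Lemma standard_J_sqr : standard_J *m standard_J = - 1%:M.
Proof.
rewrite mulmx_block !mul0mx !mulmx0 !mul1mx mulmx1 !add0r addr0.
by rewrite [in RHS]scalar_mx_block opp_block_mx oppr0.
Qed.

Lemma standard_J_orthogonal : standard_J *m standard_J^T = 1%:M.
Proof.
rewrite tr_block_mx mulmx_block !trmx0 linearN /= !trmx1.
rewrite !mul0mx !mulmx0 mul1mx mulNmx mul1mx opprK !add0r addr0.
by rewrite -scalar_mx_block.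
Qed.

Lemma standard_JE a c : standard_J a (lshift m c) = - (a == rshift m c)%:R /\
  standard_J a (rshift m c) = (a == lshift m c)%:R.
Proof.
rewrite -[a]splitK; case: (fintype.split a) => b /=; rewrite /standard_J.
  rewrite block_mxEul block_mxEur !mxE eq_lrshift oppr0 eq_lshift//.
by rewrite block_mxEdl block_mxEdr !mxE eq_rlshift eq_rshift.
Qed.

Lemma complex_torus_integrable : integrable_acs (A := A) (fun _ _ => standard_J).
Proof.
exists B; split; [exact: complex_torus_holomorphic|exact: complex_torus_smooth|].
move=> c d y [p [dc dd] <-] a k; set x := torus_coord c p.
have dx : torus_dom d (torus_pi x) by rewrite torus_coordK.
have [v _ [_ H]] := torus_coord_near dx.
(* Near x the k-th complex coordinate is x_k + 'i y_k up to a constant. *)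
have E b : cpartial b (fun x => transition (A := A) (B := B) c d x 0 k) x =
    (b == lshift m k)%:R +i* (b == rshift m k)%:R.
  have P (i : 'I_(m + m)) : partial b (fun y => (y + v) 0 i) x = (b == i)%:R.
    rewrite -pdE (_ : (fun y => (y + v) 0 i) = fun y => y 0 i + (cst (v 0 i) y)).
      rewrite partialD ?partial_coord ?partial_cst ?addr0// => z.
        exact: Coo_derivable (Coo_coord _).
    by apply/funext => z; rewrite mxE.
  rewrite /cpartial; congr (_ +i* _); rewrite -P; apply: partial_near;
    by apply: filterS H => z /= E; rewrite /transition /= /ccoord E mxE.
rewrite E.
have [J1 J2] := standard_JE a k.
have EJ b : (standard_J a b)%:C * cpartial b (fun x => transition (A := A) (B := B) c d x 0 k) x =
    (standard_J a b * (b == lshift m k)%:R) +i* (standard_J a b * (b == rshift m k)%:R).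
  by rewrite E; simpc.
under eq_bigr do rewrite EJ.
(* The deltas select two columns of J, and these are the two parts of 'i dz_k. *)
transitivity (standard_J a (lshift m k) +i* standard_J a (rshift m k)); last first.
  by rewrite J1 J2; simpc.
have D (j : 'I_(m + m)) : \sum_b standard_J a b * (b == j)%:R = standard_J a j.
  by rewrite (bigD1 j)//= eqxx mulr1 big1 ?addr0// => b /negbTE ->; rewrite mulr0.
apply/eqP; rewrite eq_complex !raddf_sum /=.
by rewrite !D !eqxx.
Qed.

End ComplexTorus.

(** * Forms on the torus *)

Section Locality.
Context {R : realType} {n : nat} (g : 'rV[R]_n -> 'M[R]_n).
Local Open Scope complex_scope.

(** Equality near y also holds near each z close to y, so derivatives agree on a neighbourhood and
    the argument can be iterated up to the Laplacian. *)
Lemma ext_d_near k (w w' : local_form R n k) (y : 'rV[R]_n) :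
  (forall t, \near y, w t y = w' t y) ->
  forall t, \near y, ext_d w t y = ext_d w' t y.
Proof.
move=> H t.
have : \near y, forall j : 'I_k.+1,
    cpartial (tnth t j) (w [tuple tnth t (lift j l) | l < k]) y =
    cpartial (tnth t j) (w' [tuple tnth t (lift j l) | l < k]) y.
  apply: (@filter_forall _ _ (fun (j : 'I_k.+1) z =>
    cpartial (tnth t j) (w [tuple tnth t (lift j l) | l < k]) z =
    cpartial (tnth t j) (w' [tuple tnth t (lift j l) | l < k]) z) _ (nbhs_filter y)) => j.
  apply: filterS (nbhs_interior (H [tuple tnth t (lift j l) | l < k])) => z Hz.
  by rewrite /cpartial; congr (_ +i* _); apply: partial_near;
     apply: filterS Hz => x /= ->.
by apply: filterS => z Hz; apply: eq_bigr => j _; rewrite Hz.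
Qed.

Lemma hodge_star_near k m (w w' : local_form R n k) (y : 'rV[R]_n) :
  (forall t, \near y, w t y = w' t y) ->
  forall t : m.-tuple 'I_n, \near y, hodge_star g w t y = hodge_star g w' t y.
Proof.
move=> H t; have := filter_forall (nbhs_filter y) H.
by apply: filterS => z Hz; do 2!apply: eq_bigr => ? _; rewrite Hz.
Qed.

Lemma codiff_near k (w w' : local_form R n k.+1) (y : 'rV[R]_n) :
  (forall t, \near y, w t y = w' t y) ->
  forall t, \near y, codiff g w t y = codiff g w' t y.
Proof.
move=> H t; have := hodge_star_near (ext_d_near (hodge_star_near (m := n - k.+1) H)) t.
by apply: filterS => z Hz; rewrite /codiff Hz.
Qed.

Lemma laplacian_near k (w w' : local_form R n k.+1) (y : 'rV[R]_n) :
  (forall t, \near y, w t y = w' t y) ->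
  forall t, laplacian g w t y = laplacian g w' t y.
Proof.
move=> H t; rewrite /laplacian.
rewrite (nbhs_singleton (ext_d_near (codiff_near H) t)).
by rewrite (nbhs_singleton (codiff_near (ext_d_near H) t)).
Qed.

Lemma ext_d_cst k (w : k.-tuple 'I_n -> R[i]) :
  ext_d (fun t (_ : 'rV[R]_n) => w t) = fun _ _ => 0.
Proof.
apply/funext => t; apply/funext => y; rewrite /ext_d big1// => j _.
rewrite /cpartial -pdE !partial_cst.
exact: mulr0.
Qed.

Lemma hodge_star0 k m :
  hodge_star g (fun (_ : k.-tuple 'I_n) _ => 0) =
  (fun (_ : m.-tuple 'I_n) _ => 0 : R[i]).
Proof.
apply/funext => t; apply/funext => y; rewrite /hodge_star big1// => a _.
by rewrite big1// => b _; rewrite mulr0.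
Qed.

Lemma codiff0 k : codiff g (fun (_ : k.+1.-tuple 'I_n) _ => 0) =
  (fun (_ : k.-tuple 'I_n) _ => 0 : R[i]).
Proof.
apply/funext => t; apply/funext => y.
by rewrite /codiff hodge_star0 (ext_d_cst (fun=> 0)) hodge_star0 mulr0.
Qed.

End Locality.

Lemma laplacian_cst (R : realType) n k (w : k.+1.-tuple 'I_n -> R[i]%C) :
  laplacian (fun=> 1%:M) (fun t (_ : 'rV[R]_n) => w t) = fun _ _ => 0.
Proof.
apply/funext => t; apply/funext => y; rewrite /laplacian ext_d_cst codiff0 addr0.
have -> : codiff (fun=> 1%:M) (fun t (_ : 'rV[R]_n) => w t) = fun _ _ => 0.
  apply/funext => s; apply/funext => z; rewrite /codiff.
  (* Neither the flat metric nor the form depends on the point, so the star evaluated anywhere is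
     convertible to its value at 0. *)
  have -> : hodge_star (m := n - k.+1) (fun=> 1%:M) (fun t (_ : 'rV[R]_n) => w t) =
      fun s (_ : 'rV[R]_n) =>
        hodge_star (fun=> 1%:M) (fun t (_ : 'rV[R]_n) => w t) s 0 by [].
  by rewrite ext_d_cst hodge_star0 mulr0.
by rewrite (ext_d_cst (fun=> 0)).
Qed.

(** * One-forms on the torus as periodic forms on R^n *)

Section TorusForms.
Context (R : realType) (n : nat).
Local Notation A := (torus_atlas R n).
Local Open Scope complex_scope.

Lemma sum_tuple1_identity (t : 1.-tuple 'I_n) (F : 1.-tuple 'I_n -> R[i]) :
  \sum_(s : 1.-tuple 'I_n)
    (\prod_(l < 1) (1%:M : 'M[R]_n) (tnth t l) (tnth s l))%:C * F s = F t.
Proof.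
rewrite (bigD1 t)//= big_ord_recl big_ord0 mxE eqxx mulr1 mul1r big1 ?addr0// => s st.
rewrite big_ord_recl big_ord0 mxE (_ : (_ == _) = false) ?mul0r//.
apply: contraNF st => /eqP E; apply/eqP/eq_from_tnth => l.
by rewrite (ord1 l).
Qed.

Lemma is_form1_transition (w : chart_index A -> local_form R n 1) c d y t :
  is_form w -> overlap c d y -> w c t y = w d t (transition c d y).
Proof.
move=> [_ _ Hw _] ov; rewrite (Hw c d y ov t) torus_transition_jacobian//.
exact: sum_tuple1_identity.
Qed.

Variables (w : chart_index A -> local_form R n 1) (fw : is_form w).

(* A form on the torus as a periodic form on R^n; the form at y is read in the
   chart centered at y. *)
Definition periodic_form : local_form R n 1 := fun t y => w (y : chart_index A) t y.

Lemma periodic_formE (c : chart_index A) y t : ball (c : 'rV[R]_n) 2^-1 y ->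
  periodic_form t y = w c t y.
Proof.
move=> cy; have yy : ball y (2^-1 : R) y by apply: ballxx; exact: half_gt0.
have ov : overlap (c : chart_index A) (y : chart_index A) y.
  by apply/torus_overlapP; split=> //; exists y.
rewrite (is_form1_transition t fw ov) /transition /=.
by rewrite torus_coord_pi.
Qed.

Lemma periodic_form_near (c : chart_index A) (y : 'rV[R]_n) : ball (c : 'rV[R]_n) 2^-1 y ->
  forall t, \near y, periodic_form t y = w c t y.
Proof.
move=> cy t; have : nbhs y (ball (c : 'rV[R]_n) 2^-1).
  by apply: open_nbhs_nbhs; split=> //; exact: ball_open.
by apply: filterS => z /periodic_formE.
Qed.

(** The charts centered at y and y + v both contain the projection of y, with coordinates y and y +
    v, and the transition does not change components. *)
Lemma periodic_form_periodic t : lattice_periodic (periodic_form t).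
Proof.
move=> y v lv; rewrite /periodic_form.
have yy (z : 'rV[R]_n) : ball z (2^-1 : R) z by apply: ballxx; exact: half_gt0.
have ov : overlap (y : chart_index A) (y + v : chart_index A) y.
  apply/torus_overlapP; split=> //; exists (y + v) => //; exact: torus_piD.
rewrite (is_form1_transition t fw ov) /transition /=.
by rewrite -(torus_piD y lv) torus_coord_pi.
Qed.

Lemma periodic_form_Coo t : Coo (fun y => complex.Re (periodic_form t y)) /\
  Coo (fun y => complex.Im (periodic_form t y)).
Proof.
have yy (z : 'rV[R]_n) : ball z (2^-1 : R) z by apply: ballxx; exact: half_gt0.
have [sw _ _ _] := fw.
have S (P : R[i] -> R) : (forall c s, smooth (chart_image c) (fun y => P (w c s y))) ->
    Coo (fun y => P (periodic_form t y)).
  move=> sP; apply/CooP => s h y _.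
  (* The chart used by [periodic_form] moves with the point; on this ball the fixed chart centered
     at y gives the same values. *)
  have H : smooth (ball y (2^-1 : R)) (fun y => P (periodic_form t y)).
    apply: (smooth_near (V := ball y (2^-1 : R))) => z yz.
    exists (fun z => P (w (y : chart_index A) t z)).
      by rewrite -(torus_chart_imageE (y : chart_index A)); exact: sP.
    split=> //; have := periodic_form_near (c := y) yz t.
    by apply: filterS => x ->.
  exact: (H s y (yy y)).
by split; apply: S => c s; have [] := sw c s.
Qed.

End TorusForms.

(** * The conformal factor *)

Section ConformalFactor.
Context {R : realType}.

(** Converse of [is_derive_line] at t = 0; it reduces sine and cosine of a coordinate to the
    one-variable chain rule. *)
Lemma is_derive_from_line n (f : 'rV[R]_n -> R) y (v : 'rV[R]_n) (d : R) :
  is_derive (0 : R) 1 (fun s : R => f (y + s *: v)) d -> is_derive y v f d.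
Proof.
have E : (fun h : R => h^-1 *: (f (y + (h *: 1 + 0) *: v) - f (y + 0 *: v))) =
         (fun h : R => h^-1 *: (f (h *: v + y) - f y)).
  apply/funext => h; congr (_ *: (f _ - f _)); last by rewrite scale0r addr0.
  by rewrite addr0 [h *: 1]mulr1 addrC.
case=> df Df; apply: DeriveDef.
  by move: df; rewrite /derivable/= E.
by move: Df; rewrite /derive/= E.
Qed.

Local Notation tau := (trigo.pi *+ 2 : R).
Let S n (i : 'I_n) (y : 'rV[R]_n) := sin (tau * y 0 i).
Let C n (i : 'I_n) (y : 'rV[R]_n) := cos (tau * y 0 i).

Let is_derive_S n (i a : 'I_n) y :
  is_derive y (delta_mx 0 a) (S i) ((a == i)%:R * tau * C i y).
Proof.
apply: is_derive_from_line; rewrite /S.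
rewrite (_ : (fun s : R => _) =
    sin \o (fun s : R => tau * y 0 i + s * ((a == i)%:R * tau))); last first.
  by apply/funext => s /=; rewrite !mxE eqxx /= eq_sym; congr sin; ring.
apply: is_derive_eq.
by rewrite /= mul0r addr0 /C scaler0 !add0r mul1r [_%:A]mulr1 mulrC.
Qed.

Let is_derive_C n (i a : 'I_n) y :
  is_derive y (delta_mx 0 a) (C i) ((a == i)%:R * tau * - S i y).
Proof.
apply: is_derive_from_line; rewrite /C.
rewrite (_ : (fun s : R => _) =
    cos \o (fun s : R => tau * y 0 i + s * ((a == i)%:R * tau))); last first.
  by apply/funext => s /=; rewrite !mxE eqxx /= eq_sym; congr cos; ring.
apply: is_derive_eq.
by rewrite /= mul0r addr0 /S scaler0 !add0r mul1r [_%:A]mulr1 mulrC.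
Qed.

(** A simultaneous induction, each of the two functions being up to a factor the derivative of the
    other. *)
Let Ck_SC n (i : 'I_n) k : Ck k (S i) /\ Ck k (C i).
Proof.
have cS y : {for y, continuous (S i)} /\ forall a, derivable (S i) y (delta_mx 0 a).
  split=> [|a]; last by have [] := is_derive_S i a y.
  apply: (continuous_comp (f := fun y : 'rV[R]_n => tau * y 0 i)).
    exact: Coo_continuous (CooZ _ (Coo_coord _)) _.
  exact: continuous_sin.
have cC y : {for y, continuous (C i)} /\ forall a, derivable (C i) y (delta_mx 0 a).
  split=> [|a]; last by have [] := is_derive_C i a y.
  apply: (continuous_comp (f := fun y : 'rV[R]_n => tau * y 0 i)).
    exact: Coo_continuous (CooZ _ (Coo_coord _)) _.
  exact: continuous_cos.
elim: k => [|k [kS kC]]; first by split; split; [exact: cS| |exact: cC|].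
split.
  split=> [|a]; first exact: cS.
  have -> : pd a (S i) = fun y => (a == i)%:R * tau * C i y.
    by apply/funext => y; rewrite pdE; have [_ <-] := is_derive_S i a y.
  by apply: CkM => //; exact: Coo_cst.
split=> [|a]; first exact: cC.
have -> : pd a (C i) = fun y => ((a == i)%:R * tau * -1) * S i y.
  by apply/funext => y; rewrite pdE /partial; have [_ ->] := is_derive_C i a y; ring.
by apply: CkM => //; exact: Coo_cst.
Qed.

Definition conformal_factor n (i : 'I_n) (y : 'rV[R]_n) : R := 2 + S i y.

Lemma conformal_factor_Coo n (i : 'I_n) : Coo (conformal_factor i).
Proof.
apply: CooD; first exact: Coo_cst.
by move=> k; have [] := Ck_SC i k.
Qed.

Lemma conformal_factor_gt0 n (i : 'I_n) y : 0 < conformal_factor i y.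
Proof.
by rewrite /conformal_factor -[2]/(1 + 1) -addrA ltr_pwDl// addrC -lerBlDr sub0r sin_geN1.
Qed.

Lemma sin_int_period (x : R) (k : int) : sin (x + tau * k%:~R) = sin x.
Proof.
have P (z : R) (m : nat) : sin (z + tau * m%:R) = sin z.
  by rewrite mulr_natr; exact: (periodicn (@sinD2pi R)).
case: (intP k) => [|m|m]; first by rewrite mulr0 addr0.
  exact: P.
by rewrite -(P (x + _) m.+1) rmorphN mulrN subrK.
Qed.

Lemma conformal_factor_periodic n (i : 'I_n) : lattice_periodic (conformal_factor i).
Proof.
move=> y v lv; have /intrP[k Ek] := lv i.
by rewrite /conformal_factor /S mxE mulrDr Ek sin_int_period.
Qed.

Lemma partial_conformal_factor n (i a : 'I_n) :
  pd a (conformal_factor i) = fun y => (a == i)%:R * tau * cos (tau * y 0 i).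
Proof.
rewrite /conformal_factor partialD; last 2 first.
- by move=> y; exact: derivable_cst.
- by move=> y; have [] := is_derive_S i a y.
apply/funext => y; rewrite partial_cst add0r pdE /partial.
by have [_ ->] := is_derive_S i a y.
Qed.

End ConformalFactor.

(** * Comparison of the two metrics *)

Section TorusExample.
Context {R : realType}.
Local Notation A := (torus_atlas R 4).
Local Open Scope complex_scope.

Local Notation l := (@lshift 2 2).
Local Notation r := (@rshift 2 2).

Definition torus_J : chart_index A -> 'rV[R]_4 -> 'M[R]_4 :=
  fun _ _ => standard_J R 2.

Definition flat_metric : chart_index A -> 'rV[R]_4 -> 'M[R]_4 := fun _ _ => 1%:M.

Definition conformal_metric : chart_index A -> 'rV[R]_4 -> 'M[R]_4 :=
  fun _ y => (conformal_factor (l 0) y)%:M.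

Lemma ord4_cases (P : 'I_4 -> Prop) :
  (forall c, P (l c)) -> (forall c, P (r c)) -> forall a, P a.
Proof. by move=> Pl Pr a; rewrite -(@splitK 2 2 a); case: (fintype.split _). Qed.

(** The equations at x_c are the right hand side; those at y_c read - W_(x_c) = 'i W_(y_c) and
    follow by multiplying with 'i. *)
Lemma torus_J_sum (W : 'I_4 -> R[i]) :
  (forall a, \sum_b (standard_J R 2 a b)%:C * W b = 'i * W a) <->
  (forall c, W (r c) = 'i * W (l c)).
Proof.
have Sl c : \sum_b (standard_J R 2 (l c) b)%:C * W b = W (r c).
  rewrite (bigD1 (r c))//= big1 ?addr0 => [|b].
    by rewrite (@standard_JE R 2 (l c) c).2 eqxx mul1r.
  elim/ord4_cases: b => d; rewrite ?(@standard_JE R 2 (l c) d).1 ?(@standard_JE R 2 (l c) d).2.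
    by rewrite (@eq_lrshift 2 2) oppr0 mul0r.
  by rewrite (@eq_rshift 2 2) (@eq_lshift 2 2) eq_sym => /negbTE ->; rewrite mul0r.
have Sr c : \sum_b (standard_J R 2 (r c) b)%:C * W b = - W (l c).
  rewrite (bigD1 (l c))//= big1 ?addr0 => [|b].
    by rewrite (@standard_JE R 2 (r c) c).1 eqxx rmorphN mulN1r.
  elim/ord4_cases: b => d; rewrite ?(@standard_JE R 2 (r c) d).1 ?(@standard_JE R 2 (r c) d).2.
    by rewrite (@eq_lshift 2 2) (@eq_rshift 2 2) eq_sym => /negbTE ->; rewrite oppr0 mul0r.
  by rewrite (@eq_rlshift 2 2) mul0r.
split=> [H c|H]; first by rewrite -Sl.
elim/ord4_cases => c; first by rewrite Sl.
by rewrite Sr H mulrA -expr2 sqr_i mulN1r.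
Qed.

Definition dz_coef (j : 'I_2) (p : 'I_4) : R[i] := (p == l j)%:R +i* (p == r j)%:R.

(** The value 0 off the chart is imposed by the normalization in [is_form]. *)
Definition dz (j : 'I_2) : chart_index A -> local_form R 4 1 := fun c t y =>
  if `[< ball (c : 'rV[R]_4) 2^-1 y >] then dz_coef j (tnth t ord0) else 0.

Lemma dz_chart j c t (y : 'rV[R]_4) : ball (c : 'rV[R]_4) 2^-1 y ->
  dz j c t y = dz_coef j (tnth t ord0).
Proof. by move=> cy; rewrite /dz; case: asboolP. Qed.

Lemma dz_near j c t (y : 'rV[R]_4) : ball (c : 'rV[R]_4) 2^-1 y ->
  \near y, dz j c t y = dz_coef j (tnth t ord0).
Proof.
move=> cy; have : nbhs y (ball (c : 'rV[R]_4) 2^-1).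
  by apply: open_nbhs_nbhs; split=> //; exact: ball_open.
by apply: filterS => z; exact: dz_chart.
Qed.

Lemma dz_is_form j : is_form (dz j).
Proof.
split.
- move=> c t; rewrite torus_chart_imageE.
  have S (P : R[i] -> R) : smooth (ball (c : 'rV[R]_4) 2^-1) (fun y => P (dz j c t y)).
    apply: (smooth_near (V := setT)) => y cy.
    exists (fun=> P (dz_coef j (tnth t ord0))); first exact/CooP/Coo_cst.
    by split=> //; have := dz_near j t cy; apply: filterS => z ->.
  by split; exact: S.
- move=> c t y _ s; rewrite (_ : s = 1%g); last first.
    by apply/permP => a; rewrite !(ord1 (_ a)).
  rewrite odd_perm1 expr0 mul1r; congr (dz j c _ y).
  by apply: eq_from_tnth => a; rewrite tnth_mktuple perm1.
- move=> c d y ov t; rewrite torus_transition_jacobian//.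
  have /torus_overlapP[cy [z bz Ez]] := ov.
  rewrite (sum_tuple1_identity t (fun s => dz j d s _)) !dz_chart//.
  rewrite /transition /= -Ez.
  by have [] := torus_coordP (c := d) (p := torus_pi z) (ex_intro2 _ _ z bz erefl).
- move=> c t y; rewrite torus_chart_imageE /dz => ncy.
  by case: asboolP.
Qed.

Lemma dz_harmonic j : harmonic10 torus_J flat_metric (dz j).
Proof.
split.
  split; first exact: dz_is_form.
  move=> c y; rewrite torus_chart_imageE => cy.
  have /(torus_J_sum (dz_coef j)).2 H :
      forall d, dz_coef j (r d) = 'i * dz_coef j (l d).
    move=> d; rewrite /dz_coef (@eq_rlshift 2 2) (@eq_lrshift 2 2) (@eq_rshift 2 2) (@eq_lshift 2 2).
    by simpc.
  move=> a; rewrite dz_chart// -H.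
  by apply: eq_bigr => b _; rewrite dz_chart.
move=> c y; rewrite torus_chart_imageE => cy t.
rewrite (@laplacian_near _ _ _ _ (dz j c) (fun s _ => dz_coef j (tnth s ord0)) y
  (fun s => dz_near j s cy)).
by rewrite /flat_metric laplacian_cst.
Qed.

Lemma flat_h10_ge2 : (2%:R%:E <= h10 torus_J flat_metric)%E.
Proof.
apply: ereal_sup_ubound; exists 2%N => //; exists dz; split.
  exact: dz_harmonic.
(* The dx_j component at the origin, in the chart centered there, isolates c j. *)
move=> c Hc j; have := Hc 0 [tuple l j] 0.
have b0 : ball (0 : 'rV[R]_4) (2^-1 : R) 0 by apply: ballxx; exact: half_gt0.
rewrite (bigD1 j)//= big1 ?addr0 => [|i ij].
  rewrite dz_chart// (_ : tnth _ _ = l j)// /dz_coef eqxx (@eq_lrshift 2 2).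
  by rewrite mulr1.
rewrite dz_chart// (_ : tnth _ _ = l j)// /dz_coef (@eq_lrshift 2 2).
rewrite (@eq_lshift 2 2) eq_sym (negbTE ij); exact: mulr0.
Qed.

(** All components are constant, the dx_1 component vanishes, and type (1,0) determines the dy
    components; alpha is the dx_2 component. Indices start at 0, so [dz 1] is dz_2. *)
Lemma conformal_harmonic w : harmonic10 torus_J conformal_metric w ->
  exists alpha, forall c t y, w c t y = alpha * dz 1 c t y.
Proof.
move=> [[fw w10] Hw]; pose W := periodic_form w.
have yy (z : 'rV[R]_4) : ball z (2^-1 : R) z by apply: ballxx; exact: half_gt0.
pose phi := conformal_factor (R := R) (l 0).
have WL t y : laplacian (fun y => (phi y)%:M) W t y = 0.
  have cy : chart_image (y : chart_index A) y by rewrite torus_chart_imageE.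
  rewrite -(Hw (y : chart_index A) y cy t); apply: laplacian_near => s.
  exact: (periodic_form_near fw (c := (y : chart_index A)) (yy y)).
have Wr c y : W [tuple r c] y = 'i * W [tuple l c] y.
  have cy : chart_image (y : chart_index A) y by rewrite torus_chart_imageE.
  have := (torus_J_sum (fun b => W [tuple b] y)).1; apply=> a.
  exact: (w10 (y : chart_index A) y cy a).
pose u t y := complex.Re (W t y); pose v t y := complex.Im (W t y).
have cu t : Coo (u t) by have [] := periodic_form_Coo fw t.
have cv t : Coo (v t) by have [] := periodic_form_Coo fw t.
have pu t : lattice_periodic (u t).
  by move=> y z lz; rewrite /u /W periodic_form_periodic.
have pv t : lattice_periodic (v t).
  by move=> y z lz; rewrite /v /W periodic_form_periodic.
have Lu b y : rlaplacian (fun y => (phi y)%:M) u [tuple b] y = 0.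
  by rewrite -(Rlinear_part_laplacian Re_Rlinear_part) WL.
have Lv b y : rlaplacian (fun y => (phi y)%:M) v [tuple b] y = 0.
  by rewrite -(Rlinear_part_laplacian Im_Rlinear_part) WL.
have ur c y : u [tuple r c] y = - v [tuple l c] y.
  by rewrite /u Wr /v; case: (W _ y) => a b /=; rewrite mul0r mul1r sub0r.
have vr c y : v [tuple r c] y = u [tuple l c] y.
  by rewrite /v Wr /u; case: (W _ y) => a b /=; rewrite mul0r mul1r add0r.
have cphi : Coo phi by exact: conformal_factor_Coo.
have pphi : lattice_periodic phi by exact: conformal_factor_periodic.
have phi_gt0 y : 0 < phi y by exact: conformal_factor_gt0.
have phi_k b : b != l 0 -> pd b phi = fun=> 0.
  move=> /negbTE b0; rewrite partial_conformal_factor b0.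
  by apply/funext => y; rewrite !mul0r.
have Wc p y : W [tuple p] y = W [tuple p] 0.
  have [E1 E2] := harmonic10_constant cphi pphi phi_gt0 phi_k (fun p => cu _)
    (fun p => pu _) Lu (fun p => cv _) (fun p => pv _) Lv ur vr p y.
  by apply/eqP; rewrite eq_complex; apply/andP; split; apply/eqP.
have W0 : W [tuple l 0] 0 = 0.
  (* A quarter period: d_1 phi = 2 pi cos (2 pi x_1) vanishes here, and is 2 pi at the origin. *)
  pose y0 : 'rV[R]_4 := 4^-1 *: delta_mx 0 (l 0).
  have phi0 : pd (l 0) phi y0 = 0.
    rewrite partial_conformal_factor !mxE !eqxx mulr1 (_ : _ / 4 = trigo.pi / 2).
      by rewrite cos_pihalf mulr0.
    by field.
  have phi1 : pd (l 0) phi 0 != 0.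
    rewrite partial_conformal_factor eqxx mxE mulr0 cos0 mulr1 mul1r.
    by rewrite mulrn_eq0 /= lt0r_neq0// pi_gt0.
  have [E1 E2] := harmonic10_vanish cphi pphi phi_gt0 phi_k (fun p => cu _)
    (fun p => pu _) Lu (fun p => cv _) (fun p => pv _) Lv ur vr phi0 phi1.
  by apply/eqP; rewrite eq_complex; apply/andP; split; apply/eqP.
exists (W [tuple l 1] 0) => c t y.
have [cy|ncy] := pselect (ball (c : 'rV[R]_4) 2^-1 y); last first.
  have [_ _ _ H] := fw; rewrite H ?torus_chart_imageE// /dz.
  by case: asboolP => //; rewrite mulr0.
rewrite -(periodic_formE fw t cy) -/W dz_chart// {1}(tuple1_eta t) Wc.
have I2 (Q : 'I_2 -> Prop) : Q 0 -> Q 1 -> forall j, Q j.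
  by move=> Q0 Q1 [[|[|]]// k]; [move: Q0|move: Q1]; congr Q; exact: val_inj.
elim/ord4_cases: (tnth t ord0); elim/I2; rewrite /dz_coef.
- by rewrite W0 (@eq_lshift 2 2) (@eq_lrshift 2 2) /= mulr0.
- by rewrite eqxx (@eq_lrshift 2 2) /= mulr1.
- by rewrite Wr W0 (@eq_rlshift 2 2) (@eq_rshift 2 2) /= !mulr0.
- by rewrite Wr (@eq_rlshift 2 2) eqxx mulrC.
Qed.

Lemma conformal_h10_le1 : (h10 torus_J conformal_metric <= 1%:R%:E)%E.
Proof.
apply: ge_ereal_sup => _ [m [b [Hb free_b]] <-]; rewrite lee_fin ler_nat.
rewrite leqNgt; apply/negP => m2.
have /choice[alpha Halpha] : forall i, exists alpha, forall c t y,
    b i c t y = alpha * dz 1 c t y by move=> i; exact: conformal_harmonic.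
have [i0 [i1 i01]] : exists i0 i1 : 'I_m, i1 != i0.
  by exists (Ordinal (ltnW m2)), (Ordinal m2).
(* A nontrivial relation between two multiples of one form: the first is zero if its coefficient is,
   otherwise they are cross-multiplied and c i1 = - alpha i0 is nonzero. *)
pose c i : R[i] := if alpha i0 == 0 then (i == i0)%:R
  else alpha i1 * (i == i0)%:R - alpha i0 * (i == i1)%:R.
have H : forall i, c i = 0.
  apply: free_b => d t y; under eq_bigr do rewrite Halpha mulrA.
  rewrite -mulr_suml (bigD1 i0)// (bigD1 i1)//= big1 => [|i /andP[/negbTE e0 /negbTE e1]].
    rewrite /c !eqxx [i0 == i1]eq_sym !(negbTE i01).
    by case: eqP => [->|_] /=; ring.
  by rewrite /c e0 e1; case: ifP => _ /=; ring.
have := H i0; have := H i1; rewrite /c !eqxx [i0 == i1]eq_sym !(negbTE i01).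
case: eqP => [_ _ /eqP|a0]; first by rewrite oner_eq0.
by rewrite mulr0 mulr1 sub0r => /eqP; rewrite oppr_eq0 => /eqP.
Qed.

Lemma torus_h10_neq : h10 torus_J flat_metric <> h10 torus_J conformal_metric.
Proof.
move=> E; have := le_trans flat_h10_ge2; rewrite E => /(_ _ conformal_h10_le1).
by rewrite lee_fin ler_nat.
Qed.

Lemma torus_J_hermitian :
  almost_hermitian torus_J flat_metric /\ almost_hermitian torus_J conformal_metric.
Proof.
have JJ := standard_J_orthogonal R 2; split.
  apply: (torus_almost_hermitian (phi := fun=> 1) JJ) => //; exact: Coo_cst.
apply: (torus_almost_hermitian JJ).
- exact: conformal_factor_Coo.
- exact: conformal_factor_periodic.
- exact: conformal_factor_gt0.
Qed.

End TorusExample.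

Theorem theorem4p1 (R : realType) :
  (exists (M : topologicalType) (A : atlas R 4 M)
          (J g g' : chart_index A -> 'rV[R]_4 -> 'M[R]_4),
     compact [set: M] /\ smooth_manifold A /\ almost_complex J /\
     almost_hermitian J g /\ almost_hermitian J g' /\
     h10 J g <> h10 J g') /\
  (exists (M : topologicalType) (A : atlas R 4 M)
          (J g g' : chart_index A -> 'rV[R]_4 -> 'M[R]_4),
     compact [set: M] /\ smooth_manifold A /\ almost_complex J /\
     integrable_acs (m := 2) J /\
     almost_hermitian J g /\ almost_hermitian J g' /\
     h10 J g <> h10 J g').
Proof.
have [H1 H2] := @torus_J_hermitian R.
have cJ := torus_almost_complex (standard_J_sqr R 2).
have hM := @torus_smooth_manifold R 4.
have cM := @torus_compact R 4.
(* One example serves both claims, since its J is integrable. *)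
split; exists (torus R 4), (torus_atlas R 4), torus_J, flat_metric, conformal_metric.
  exact: (conj cM (conj hM (conj cJ (conj H1 (conj H2 torus_h10_neq))))).
have iJ := complex_torus_integrable R 2.
exact: (conj cM (conj hM (conj cJ (conj iJ (conj H1 (conj H2 torus_h10_neq)))))).
Qed.
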